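(* Fix a domain of size $n$ and a prime $p\in\mathcal{O}(n^c)$ for a constant $c$. For $k=\frac{\log n}{\log\log n}$, the value $\det(A)$ of a matrix $A\in\mathbb{Z}_p^{k\times k}$ can be defined in $\mathrm{FO}(+,\times)$.
   Context: $\mathrm{FO}(+,\times)$ denotes first-order logic over structures with built-in linear order, addition and multiplication relations on the domain. Numbers from $\{0,\dots,n^{c}-1\}$ are encoded by $c$-tuples of domain elements; a matrix is given by a relation containing $(\bar r,\bar c,\bar v)$ iff the entry at row $\bar r$, column $\bar c$ is $\bar v$. ''Defined'' means there is a formula that, given these relations (and $p$), defines the value of the determinant modulo $p$. *)

(* Defs.v *)
From mathcomp Require Import all_boot all_order all_algebra.
From mathcomp Require Import reals exp.

Set Implicit Arguments.
Unset Strict Implicit.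
Unset Printing Implicit Defensive.

Import Order.TTheory GRing.Theory Num.Theory.

Local Open Scope nat_scope.

(* The symbol fMat has arity 3 * d, its arguments being grouped as a row, a
   column and a value.  V is the type of free variables: a quantifier binds
   the variable None of its body and renames the free variables x to Some x. *)
Inductive formula (d : nat) (V : Type) : Type :=
| fEq of V & V
| fLe of V & V
| fAdd of V & V & V
| fMul of V & V & V
| fMat of d.-tuple V & d.-tuple V & d.-tuple V
| fNot of formula d V
| fAnd of formula d V & formula d V
| fOr of formula d V & formula d V
| fEx of formula d (option V)
| fAll of formula d (option V).

(* The domain is {0, ..., n - 1}; fAdd and fMul are the graphs of addition and
   multiplication of natural numbers, restricted to the domain. *)
Fixpoint sat (n d : nat) (M : d.-tuple 'I_n -> d.-tuple 'I_n -> d.-tuple 'I_n -> bool)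
    (V : Type) (e : V -> 'I_n) (phi : formula d V) {struct phi} : bool :=
  match phi with
  | fEq x y => e x == e y
  | fLe x y => e x <= e y
  | fAdd x y z => e x + e y == e z :> nat
  | fMul x y z => e x * e y == e z :> nat
  | fMat r c v => M (map_tuple e r) (map_tuple e c) (map_tuple e v)
  | fNot f => ~~ sat M e f
  | fAnd f g => sat M e f && sat M e g
  | fOr f g => sat M e f || sat M e g
  | fEx f => [exists a : 'I_n, sat M (oapp e a) f]
  | fAll f => [forall a : 'I_n, sat M (oapp e a) f]
  end.

(* Base n, least significant digit first. *)
Definition tuple_num (n d : nat) (t : d.-tuple 'I_n) : nat :=
  \sum_(i < d) tnth t i * n ^ i.

(* An element of 'F_p, p prime, coerces to its representative in
   {0, ..., p - 1}. *)
Definition mx_rel (n d p k : nat) (A : 'M['F_p]_k) (r c v : d.-tuple 'I_n) : bool :=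
  [exists i : 'I_k, exists j : 'I_k,
    [&& tuple_num r == i, tuple_num c == j & tuple_num v == A i j]].

Definition env2 (n d : nat) (x y : d.-tuple 'I_n) (s : 'I_d + 'I_d) : 'I_n :=
  match s with inl i => tnth x i | inr i => tnth y i end.

Definition log2 (R : realType) (x : R) : R := (ln x / ln 2)%R.

(* floor (log n / log log n), meaningful for n > 2, where log log n > 0. *)
Definition log_div_loglog (R : realType) (n : nat) : nat :=
  Num.truncn (log2 (n%:R : R) / log2 (log2 (n%:R : R)))%R.

(* Main.v *)
(* Let X be the determinant over the integers of the matrix of representatives.
   Since k^k <= n <= 2^O(k^2), X has O(k^3) bits, so it is determined by its
   residues modulo the primes q < k^8 other than p, whose product P is much
   larger.  A vector of k numbers of size poly(k) is a single number of size
   poly(n), hence can be quantified over.  Guessing vectors allows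
   - to iterate a definable step k^m times for constant m, k rounds at a time,
     which gives sums and products of poly(k) many small numbers;
   - to define X mod q: guess, row by row, unit triangular L and W with L W A
     upper triangular, and multiply the pivots.
   Chinese remaindering gives X / P = sum_q y_q / q - r, where r is the integer
   nearest to a rough approximation of the sum, hence
   X = P (sum_q y_q q^-1 - r) modulo p.  The same identity for X = 1 yields the
   inverse of P modulo p, so P itself is not needed.
   Numbers of size poly(n) are tuples of domain elements; equations between
   them are verified modulo all m with m^2 < n, and sums of poly(k) many of
   them modulo all m < k^8.  The finitely many small n are tabulated. *)

Require Import Defs.
From mathcomp Require Import all_boot all_order all_algebra.
From mathcomp Require Import reals exp.
From mathcomp Require Import perm boolp zify ring lra.

Set Implicit Arguments.
Unset Strict Implicit.
Unset Printing Implicit Defensive.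

Import Order.TTheory GRing.Theory Num.Theory.

Local Open Scope nat_scope.

(** * Prime counting *)

(** The obstacle is size: a vector of k residues modulo p has about k log n bits and is no number of
    size poly(n), so elimination modulo p cannot be guessed even row by row. Modulo q < k^8 the
    entries are k^O(1), and k^k <= n makes a vector polynomial in n. A k x k matrix still does not
    fit, so L is guessed one row at a time and W A is never stored: its entries are recomputed from
    A and the vector of row additions. Vectors are coded by remainders rather than digits, because
    remainders are expressible by addition and multiplication alone, whereas digits would need
    powers. Constants: a dot product modulo q has k terms of at most k^8 * (k * k^8), hence the
    bound k^18 on coded entries. Chebyshev's estimate pi(x^2) >= x with x = k^19 gives more than k
    primes between k^18 and k^38. With x = k^4 it explains k^8: the k^4 - 1 primes other than p
    outweigh O(k^3) bits. The central binomial coefficient C(2j, j) serves twice: it yields this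
    estimate, and it shows that a number below 2^j is determined by its residues modulo all m <=
    2j. *)

Lemma poly_lt_exp2 a c : exists L, forall l, L <= l -> c * l ^ a < 2 ^ l.
Proof.
(* One exponent is kept in reserve: l^b < b^b 2^l, and the spare factor l > c b^b absorbs both
   constants. *)
pose b := a.+1; exists (c * b ^ b).+1 => l Ll.
have b0 : 0 < b ^ b by rewrite expn_gt0.
have hl : l < (l %/ b).+1 * b by rewrite ltn_ceil.
have h1 : ((l %/ b).+1) ^ b <= 2 ^ l.
  apply: (@leq_trans (2 ^ (l %/ b * b))); last by rewrite leq_exp2l // leq_divM.
  by rewrite expnM leq_exp2r // ltn_expl.
have h2 : l ^ b < b ^ b * 2 ^ l.
  apply: (@leq_trans (((l %/ b).+1 * b) ^ b)); first by rewrite ltn_exp2r.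
  by rewrite expnMn mulnC leq_pmul2l.
rewrite -(ltn_pmul2l b0); apply: leq_ltn_trans h2.
by rewrite mulnA [b ^ b * c]mulnC [l ^ b]expnS leq_mul2r (ltnW Ll) orbT.
Qed.


(** By Legendre's formula each power q^i contributes floor(2m / q^i) - 2 floor(m / q^i), which is 0
    or 1 and vanishes once q^i > 2m. The exponent of q is therefore at most the logarithm of 2m in
    base q. *)
Lemma logn_central_bin q m : prime q -> 0 < m ->
  q ^ logn q 'C(m.*2, m) <= m.*2.
Proof.
move=> q_pr m_gt0; have q1 := prime_gt1 q_pr.
have N0 : 0 < m.*2 by rewrite double_gt0.
have mN : m <= m.*2 by rewrite -addnn leq_addr.
suff: logn q 'C(m.*2, m) <= trunc_log q m.*2.
  move=> h; apply: leq_trans (trunc_logP q1 N0); by rewrite leq_exp2l.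
have ext : \sum_(1 <= k < m.+1) m %/ q ^ k = \sum_(1 <= k < m.*2.+1) m %/ q ^ k.
  rewrite [RHS](@big_cat_nat _ _ _ m.+1) //= [X in _ = _ + X]big_nat_cond.
  rewrite [X in _ = _ + X]big1 ?addn0 // => k /andP[/andP[km _] _].
  by rewrite divn_small // (ltn_trans km) // ltn_expl.
have eqf : logn q (m.*2)`! = logn q 'C(m.*2, m) + (logn q m`!).*2.
  have /(congr1 (logn q)) := bin_fact mN.
  have -> : m.*2 - m = m by rewrite -addnn addnK.
  by rewrite !lognM ?muln_gt0 ?fact_gt0 ?bin_gt0 // addnn => <-.
have le1 : logn q (m.*2)`! <=
    (logn q m`!).*2 + \sum_(1 <= k < m.*2.+1) (q ^ k <= m.*2).
  rewrite !logn_fact // ext -!muln2 big_distrl -big_split /=.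
  apply: leq_sum => k _; set d := q ^ k.
  have d0 : 0 < d by rewrite expn_gt0 ltnW.
  have [dle|dgt] := leqP d (m * 2); last by rewrite divn_small.
  rewrite -ltnS ltn_divLR //.
  have h := ltn_ceil m d0; move: h d0; move: (m %/ d) => x; rewrite mulSn; nia.
suff le2 : \sum_(1 <= k < m.*2.+1) (q ^ k <= m.*2) <= trunc_log q m.*2.
  move: le1 le2; rewrite eqf; lia.
have tN : (trunc_log q m.*2).+1 <= m.*2.+1.
  rewrite ltnS; apply: leq_trans (trunc_logP q1 N0); exact: ltnW (ltn_expl _ q1).
rewrite (@big_cat_nat _ _ _ (trunc_log q m.*2).+1) //=.
rewrite [X in _ + X]big_nat_cond [X in _ + X]big1 ?addn0; last first.
  move=> k /andP[/andP[km _] _]; have [/(trunc_log_max q1)|] := leqP (q ^ k) m.*2; last by [].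
  by rewrite leqNgt km.
apply: (@leq_trans (\sum_(1 <= k < (trunc_log q m.*2).+1) 1)).
  by apply: leq_sum => k _; apply: leq_b1.
by rewrite sum_nat_const_nat muln1 subSS subn0.
Qed.

Lemma central_bin_ge m : 2 ^ m <= 'C(m.*2, m).
Proof.
elim: m => [|m IH] //.
have e : m.+1 * 'C(m.+1.*2, m.+1) = 2 * (m.*2.+1 * 'C(m.*2, m)).
  have h1 := mul_bin_diag m.*2.+2 m; have h2 := mul_bin_down m.*2.+1 m.
  have e2 : m.*2.+1 - m = m.+1 by lia.
  move: h1 h2; rewrite /= e2 doubleS; nia.
have : 0 < m.+1 by []; rewrite expnS; nia.
Qed.

(** Every prime power exactly dividing the binomial is at most 2m, hence is one of the j. With
    [central_bin_ge] this amounts to the lower bound 2^m on the least common multiple of 1, ...,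
    2m. *)
Lemma central_bin_dvd m z : (forall j, 0 < j <= m.*2 -> j %| z) ->
  'C(m.*2, m) %| z.
Proof.
case: m => [|m]; first by rewrite bin0 dvd1n.
move=> dv; have [->|z0] := posnP z; first by rewrite dvdn0.
apply/dvdn_partP => [|q]; first by rewrite bin_gt0 -addnn leq_addr.
rewrite mem_primes => /and3P[q_pr _ _].
rewrite p_part; apply: dv; rewrite expn_gt0 prime_gt0 //=.
exact: logn_central_bin.
Qed.

Definition nprimes n := size [seq q <- iota 0 n | prime q].

(** The binomial is at least 2^m, and it is a product of prime powers, each at most 2m, over
    distinct primes up to 2m. *)
Lemma exp_nprimes_ge m : 0 < m -> 2 ^ m <= m.*2 ^ nprimes m.*2.+1.
Proof.
move=> m0; apply: leq_trans (central_bin_ge m) _.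
have C0 : 0 < 'C(m.*2, m) by rewrite bin_gt0 -addnn leq_addr.
rewrite {1}(prod_prime_decomp C0) prime_decompE big_map /=.
set M := m.*2; set C := 'C(_, _).
apply: (@leq_trans (\prod_(q <- primes C) M)).
  rewrite big_seq [X in _ <= X]big_seq; apply: leq_prod => q.
  by rewrite mem_primes => /and3P[q_pr _ _]; apply: logn_central_bin.
rewrite big_const_seq count_predT iter_muln_1 leq_exp2l; last first.
  by rewrite /M; lia.
apply: uniq_leq_size; first exact: primes_uniq.
move=> q; rewrite mem_filter mem_iota add0n !leq0n /= => qC.
have q_pr : prime q by move: qC; rewrite mem_primes => /andP[].
rewrite q_pr /= ltnS.
have : 0 < logn q C by rewrite logn_gt0.
move=> l0; apply: leq_trans (logn_central_bin q_pr m0).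
by rewrite -{1}[q]expn1 leq_exp2l // prime_gt1.
Qed.

(** A weak form of Chebyshev's lower bound. It will count the primes below k^8 and below k^38. *)
Lemma nprimes_sqr_ge : exists x0, forall x, x0 <= x -> x <= nprimes (x ^ 2).
Proof.
have [L HL] := poly_lt_exp2 2 100.
exists (2 ^ (L + 10)) => x xge.
pose l := trunc_log 2 x.
have x0 : 0 < x by apply: leq_trans xge; rewrite expn_gt0.
have lx : 2 ^ l <= x by apply: trunc_logP.
have xl : x < 2 ^ l.+1 by apply: trunc_log_ltn.
have Ll : L + 10 <= l by apply: trunc_log_max.
have l2 : 100 * l ^ 2 < 2 ^ l by apply: HL; lia.
pose m := ((x ^ 2).-1)./2.
have x10 : 1000 < x by apply: leq_trans xge; apply: (@leq_trans (2 ^ 10)) => //; rewrite leq_exp2l //; lia.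
have mx : m.*2.+1 <= x ^ 2 by rewrite /m; nia.
have mx2 : x ^ 2 <= m.*2 + 2 by rewrite /m; nia.
have m0 : 0 < m by nia.
have h := exp_nprimes_ge m0.
have mono : nprimes m.*2.+1 <= nprimes (x ^ 2).
  rewrite /nprimes !size_filter -(subnKC mx) iotaD count_cat; lia.
have h2 : 2 ^ m <= 2 ^ ((2 * l.+1) * nprimes (x ^ 2)).
  apply: (leq_trans h); rewrite expnM.
  apply: (@leq_trans ((2 ^ (2 * l.+1)) ^ nprimes m.*2.+1)).
    rewrite leq_exp2r; last first.
      by rewrite lt0n; apply/eqP => e0; move: h; rewrite e0 expn0; have := ltn_expl m (isT : 1 < 2); lia.
    by rewrite mulnC expnM; have := leq_exp2r x (2 ^ l.+1) (isT: 0 < 2); lia.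
  by rewrite leq_exp2l // -{1}(expn0 2) ltn_exp2l.
rewrite leq_exp2l // in h2.
suff : x * (2 * l.+1) <= m by nia.
have : 100 * l < x by nia.
nia.
Qed.

(** A nonzero difference would be a multiple of C(2j, j) >= 2^j, yet it is below 2^j in absolute
    value. *)
Lemma eq_mod_small j a b : a < 2 ^ j -> b < 2 ^ j ->
  (forall m, 0 < m <= j.*2 -> a = b %[mod m]) -> a = b.
Proof.
wlog le_ab : a b / a <= b => [H aj bj E|aj bj E].
  have [/H|/ltnW/H] := leqP a b; first by apply.
  by move=> h; apply/esym/h => // m /E.
have : 'C(j.*2, j) %| b - a.
  by apply: central_bin_dvd => m /E/eqP; rewrite eq_sym eqn_mod_dvd.
have h := central_bin_ge j; have [|ba0 /(dvdn_leq ba0)] := posnP (b - a); lia.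
Qed.

(** The moduli up to 2j have squares below n, so products of residues stay in the domain, and they
    still separate the numbers below n^c: c log n is far below the square root of n. *)
Lemma sqrt_exp_room c :
  exists n0, forall n, n0 <= n -> exists2 j, j.*2 * j.*2 < n & n ^ c <= 2 ^ j.
Proof.
have [L HL] := poly_lt_exp2 2 (16 * c ^ 2).
exists (2 ^ L.+1) => n nge.
pose l := trunc_log 2 n.
have n0 : 0 < n by apply: leq_trans nge; rewrite expn_gt0.
have lx : 2 ^ l <= n by apply: trunc_logP.
have xl : n < 2 ^ l.+1 by apply: trunc_log_ltn.
have Ll : L.+1 <= l by apply: trunc_log_max.
exists (l.+1 * c); last first.
  rewrite expnM; case: (posnP c) => [->|c0] //; by rewrite leq_exp2r // ltnW.
have h := HL l (ltnW Ll).
apply: leq_trans lx; apply: leq_ltn_trans h.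
have -> : 16 * c ^ 2 * l ^ 2 = (4 * c * l) ^ 2 by rewrite !expnMn.
rewrite mulnn leq_exp2r // -mul2n mulnA [4 * c * l]mulnAC.
by apply: leq_mul => //; lia.
Qed.

(** * Triangular decomposition without pivoting *)

Section LU.
Local Open Scope ring_scope.
Variable F : fieldType.

(* Row h i is added to row i; nothing is added if h i >= k.  With h i > i this
   replaces row permutations, whose sign would have to be defined. *)
Definition addrow k (h : 'I_k -> nat) : 'M[F]_k :=
  \matrix_(i, m) ((m == i)%:R + (m == h i :> nat)%:R).

Lemma addrowE k (h : 'I_k -> nat) (B : 'M[F]_k) i j :
  (addrow h *m B) i j = B i j + \sum_(m < k | m == h i :> nat) B m j.
Proof.
rewrite mxE [in RHS]big_mkcond /=.
transitivity (\sum_m ((m == i)%:R * B m j + (m == h i :> nat)%:R * B m j)).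
  by apply: eq_bigr => m _; rewrite mxE mulrDl.
rewrite big_split /=; congr (_ + _).
  rewrite (bigD1 i) //= eqxx mul1r big1 ?addr0 // => m /negbTE->.
  by rewrite mul0r.
by apply: eq_bigr => m _; case: eqP => _; rewrite ?mul1r ?mul0r.
Qed.

Lemma det_unit_lower k (L : 'M[F]_k) :
  (forall i, L i i = 1) -> (forall i j : 'I_k, (i < j)%N -> L i j = 0) -> \det L = 1.
Proof.
move=> L1 L0; rewrite det_trig; first by rewrite big1.
by apply/is_trig_mxP => i j ij; apply: L0.
Qed.

Lemma det_upper k (U : 'M[F]_k) :
  (forall i j : 'I_k, (j < i)%N -> U i j = 0) -> \det U = \prod_i U i i.
Proof.
move=> U0; rewrite -det_tr det_trig.
  by apply: eq_bigr => i _; rewrite mxE.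
by apply/is_trig_mxP => i j ij; rewrite mxE U0.
Qed.

Lemma det_addrow k (h : 'I_k -> nat) : (forall i : 'I_k, i < h i)%N -> \det (addrow h) = 1.
Proof.
move=> hi; rewrite -det_tr; apply: det_unit_lower => [i|i j ij]; rewrite !mxE.
  by rewrite eqxx ltn_eqF ?hi // addr0.
rewrite -val_eqE /= (ltn_eqF ij) ltn_eqF ?addr0 //; exact: ltn_trans ij (hi j).
Qed.

Lemma lu_sound k (h : 'I_k -> nat) (L B : 'M[F]_k) :
  (forall i : 'I_k, i < h i)%N ->
  (forall i, L i i = 1) -> (forall i j : 'I_k, (i < j)%N -> L i j = 0) ->
  (forall i j : 'I_k, (j < i)%N -> (L *m (addrow h *m B)) i j = 0) ->
  \det B = \prod_i (L *m (addrow h *m B)) i i.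
Proof.
move=> hi L1 L0 U0; rewrite -det_upper // !det_mulmx det_addrow //.
by rewrite (det_unit_lower L1 L0) !mul1r.
Qed.

(** Induction by Schur complements. After the addition chosen for row 0 the corner is nonzero, and
    [E] clears the column below it. Moving this elimination past the later additions W' turns E into
    W' E, so all additions can precede a single L, whose lower left block is - L' W' E. *)
Lemma lu_complete k (B : 'M[F]_k) : \det B != 0 ->
  exists (h : 'I_k -> nat) (L : 'M[F]_k),
  [/\ forall i : 'I_k, (i < h i <= k)%N, forall i, L i i = 1,
      forall i j : 'I_k, (i < j)%N -> L i j = 0 &
      forall i j : 'I_k, (j < i)%N -> (L *m (addrow h *m B)) i j = 0].
Proof.
elim: k B => [|k IH] B dB.
  by exists (fun=> 0%N), 0; split=> -[].
(* If the corner is already nonzero, [h0] is [k.+1], which is out of range and means that nothing is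
   added. Otherwise it is a row with a nonzero entry in column 0, which exists because the
   determinant is nonzero. *)
have [h0 [h0P xn0]] : exists h0 : nat, (0 < h0 <= k.+1)%N /\
    B 0 0 + \sum_(m < k.+1 | m == h0 :> nat) B m 0 != 0.
  have [b0|bn0] := eqVneq (B 0 0) 0; last first.
    exists k.+1; split; first by rewrite ltnSn.
    rewrite big1 ?addr0 // => i /eqP ik.
    by have := ltn_ord i; rewrite ik ltnn.
  have [m bm] : exists m, B m 0 != 0.
    apply/existsP; apply: contraNT dB; rewrite negb_exists => /forallP b00.
    rewrite (expand_det_col B 0) big1 // => i _.
    by move: (b00 i); rewrite negbK => /eqP->; rewrite mul0r.
  exists m; rewrite b0 add0r (big_pred1 m) //; split=> //.
  rewrite (ltnW (ltn_ord m)) andbT lt0n.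
  by apply: contraNneq bm => m0; rewrite (_ : m = 0) ?b0 //; exact: val_inj.
pose w : 'rV[F]_k := \row_m (lift ord0 m == h0 :> nat)%:R.
pose B' : 'M[F]_(1 + k) := B.
pose c := dlsubmx B'; pose Dm := drsubmx B'.
pose a' := ulsubmx B' + w *m c; pose b' := ursubmx B' + w *m Dm.
have eB : B' = block_mx (ulsubmx B') (ursubmx B') c Dm by rewrite submxK.
pose x := a' 0 0.
have xE : x = B 0 0 + \sum_(m < k.+1 | m == h0 :> nat) B m 0.
  rewrite /x !mxE; congr (_ + _); first by congr (B _ _); apply: val_inj.
  rewrite [RHS]big_mkcond big_ord_recl; case: eqP h0P => [<-//|_ _].
  rewrite [RHS]add0r; apply: eq_bigr => m _; rewrite !mxE.
  case: eqP => _; rewrite ?mul1r ?mul0r //; congr (B _ _); exact: val_inj.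
have x0 : x != 0 by rewrite xE.
pose E := x^-1 *: c.
have Ea : E *m a' = c.
  by rewrite [a']mx11_scalar -/x mul_mx_scalar scalerA divff // scale1r.
pose D' := Dm - E *m b'.
have eB1 : block_mx 1%:M w 0 1%:M *m B' = block_mx a' b' c Dm.
  by rewrite eB mulmx_block !mul1mx !mul0mx !add0r.
have eB2 : block_mx 1%:M 0 (- E) 1%:M *m block_mx a' b' c Dm = block_mx a' b' 0 D'.
  by rewrite mulmx_block !mul1mx !mul0mx !addr0 !mulNmx Ea addNr addrC.
have dD : \det D' != 0.
  have : \det (block_mx a' b' 0 D') = \det B.
    rewrite -eB2 -eB1 !det_mulmx det_ublock det_lblock !det1 !mul1r.
    by [].
  by rewrite det_ublock => e; apply: contraNneq dB => d0; rewrite -e d0 mulr0.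
have [h' [L' [h'P L'1 L'0 U'0]]] := IH D' dD.
pose h (i : 'I_(1 + k)) : nat := match split i with inl _ => h0 | inr i' => (h' i').+1 end.
have hl i : h (lshift k i) = h0 by rewrite /h (unsplitK (inl _)).
have hr i : h (rshift 1 i) = (h' i).+1 by rewrite /h (unsplitK (inr _)).
have eW : addrow h = block_mx 1%:M 0 0 (addrow h') *m block_mx 1%:M w 0 1%:M.
  rewrite mulmx_block !mul1mx !mul0mx !mulmx1 !addr0 !add0r mulmx0.
  apply/matrixP => i j; rewrite mxE.
  case: (split_ordP i) => i' ->; case: (split_ordP j) => j' ->;
    rewrite ?block_mxEul ?block_mxEur ?block_mxEdl ?block_mxEdr ?hl ?hr !mxE -?val_eqE /=.
  - by rewrite !ord1 /= ltn_eqF ?addr0 //; case/andP: h0P.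
  - by rewrite !ord1 add0r.
  - by rewrite !ord1 addr0.
  - by rewrite !eqSS.
pose L : 'M[F]_(1 + k) := block_mx 1%:M 0 (- (L' *m addrow h' *m E)) L'.
have eU : L *m (addrow h *m B') = block_mx a' b' 0 (L' *m (addrow h' *m D')).
  rewrite eW -mulmxA eB1 mulmx_block !mul1mx !mul0mx !addr0 !add0r.
  rewrite mulmx_block !mul1mx !mul0mx !addr0 !mulNmx -!mulmxA Ea addNr.
  by congr block_mx; rewrite /D' !mulmxBr addrC.
suff H : [/\ forall i : 'I_(1 + k), (i < h i <= k.+1)%N,
    forall i : 'I_(1 + k), L i i = 1,
    forall i j : 'I_(1 + k), (i < j)%N -> L i j = 0 &
    forall i j : 'I_(1 + k), (j < i)%N -> (L *m (addrow h *m B')) i j = 0].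
  by exists h, L.
split.
- move=> i; case: (@split_ordP 1 k i) => i' ->; rewrite ?hl ?hr /=; first by rewrite !ord1.
  by have /andP[h1 h2] := h'P i'; rewrite add1n !ltnS h1.
- move=> i; case: (@split_ordP 1 k i) => i' ->; rewrite /L ?block_mxEul ?block_mxEdr ?L'1 //.
  by rewrite !mxE !ord1.
- move=> i j; case: (@split_ordP 1 k i) => i' ->; case: (@split_ordP 1 k j) => j' ->;
    rewrite /L ?block_mxEul ?block_mxEur ?block_mxEdl ?block_mxEdr /=.
  + by rewrite !ord1.
  + by rewrite mxE.
  + by rewrite !ord1.
  + by rewrite !add1n ltnS; apply: L'0.
move=> i j; rewrite eU; case: (@split_ordP 1 k i) => i' ->; case: (@split_ordP 1 k j) => j' ->;
    rewrite ?block_mxEul ?block_mxEur ?block_mxEdl ?block_mxEdr /=.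
- by rewrite !ord1.
- by rewrite !ord1.
- by rewrite mxE.
- by rewrite !add1n ltnS; apply: U'0.
Qed.
End LU.

Lemma eq_modFp p a b : prime p ->
  (a = b %[mod p]) <-> (a%:R = b%:R :> 'F_p)%R.
Proof.
move=> p_pr; split=> [E|/(congr1 val)]; last by rewrite /= !val_Fp_nat.
by rewrite -(Fp_nat_mod p_pr a) E Fp_nat_mod.
Qed.

Lemma Fp_lt p (x : 'F_p) : prime p -> x < p.
Proof. by move=> p_pr; have := ltn_ord x; rewrite {2}Fp_cast. Qed.

Lemma prod_primes_dvd (r : seq nat) z : uniq r -> all prime r ->
  all (fun q => q %| z) r -> \prod_(q <- r) q %| z.
Proof.
elim: r => [|q r IH] /=; first by rewrite big_nil dvd1n.
case/andP=> qr Ur /andP[q_pr r_pr] /andP[qz rz].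
rewrite big_cons Gauss_dvd ?qz ?IH // big_seq.
elim/big_ind: _ => [|u v cu cv|x xr]; first by rewrite coprimen1.
  by rewrite coprimeMr cu.
rewrite prime_coprime // dvdn_prime2 //; last exact: (allP r_pr).
by apply: (contraNN _ qr) => /eqP->.
Qed.

(** * Chinese remainder representation *)

Section CRT.
Variables (Q : seq nat) (X : int) (y : nat -> nat) (K : nat).
Hypothesis UQ : uniq Q.
Hypothesis Qpr : all prime Q.
Let P := \prod_(q <- Q) q.
Definition coprod q := \prod_(x <- Q | x != q) x.
Hypothesis XP : (4 * `|X| < P%:Z)%R.
Hypothesis KQ : 4 * size Q < K.
Hypothesis yX : {in Q, forall q, (((y q * coprod q)%:R : 'F_q) = X%:~R)%R}.

Lemma coprodM q : q \in Q -> q * coprod q = P.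
Proof. by move=> qQ; rewrite /P (bigD1_seq q). Qed.

Let S := \sum_(q <- Q) y q * coprod q.
Let R := \sum_(q <- Q) y q * K %/ q.

(** Modulo q only the term of q survives in S, and by hypothesis it equals X. *)
Lemma crt_dvd : (P%:Z %| (S%:Z - X)%R)%Z.
Proof.
rewrite /dvdz /=; apply: prod_primes_dvd => //.
apply/allP => q qQ; have q_pr := allP Qpr q qQ.
have ch := pchar_Fp q_pr.
suff : (q%:Z %| (S%:Z - X)%R)%Z by [].
rewrite (dvdz_pcharf ch).
rewrite rmorphB /= subr_eq0 -yX // /S (bigD1_seq q) //= PoszD rmorphD /=.
rewrite [X in (_ + X)%R](_ : _ = 0)%R ?addr0 //.
apply/eqP; rewrite -[_ == _](dvdn_pcharf ch).
rewrite big_seq_cond; apply: dvdn_sum => x /andP[xQ xq].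
by rewrite dvdn_mull // /coprod (big_rem q) //= eq_sym xq dvdn_mulr.
Qed.

(* R / K underestimates the sum of the y q / q by less than 1/4, and X / P is
   less than 1/4 in absolute value. *)
Lemma crt_rank : exists r : nat, (S%:Z = X + (r * P)%:Z)%R /\
  forall r', (2 * r' * K < 2 * R + K /\ 2 * R < 2 * r' * K + K) <-> r' = r.
Proof.
have P0 : 0 < P.
  by rewrite /P big_seq; apply: prodn_cond_gt0 => q /(allP Qpr)/prime_gt0.
have [r0 er0] := dvdzP crt_dvd.
have Sr : (S%:Z = X + r0 * P%:Z)%R by rewrite -er0 addrC subrK.
(* S is nonnegative and X < P, so the multiple of P cannot be negative. *)
have r0_ge : (0 <= r0)%R.
  rewrite leNgt; apply/negP => r_lt.
  have : (r0 * P%:Z <= - P%:Z)%R by rewrite -mulN1r ler_pM2r //; lia.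
  by move: Sr XP; lia.
have [r er] : exists r : nat, r0 = Posz r.
  by exists `|r0|%N; rewrite gez0_abs.
exists r; rewrite PoszM -er; split=> //.
(* Each floor in R loses less than 1, so R P <= K S <= (R + |Q|) P. With 4 |Q| < K and 4 |X| < P the
   quotient R / K lies within 1/2 of r. *)
have b1 : R * P <= K * S.
  rewrite /R /S big_distrl big_distrr /= big_seq [X in _ <= X]big_seq.
  apply: leq_sum => q qQ; rewrite -(coprodM qQ) mulnA mulnCA [y q * _]mulnC mulnA.
  rewrite [K * _]mulnC leq_mul2r; apply/orP; right; exact: leq_divM.
have b2 : K * S <= (R + size Q) * P.
  rewrite /R /S -sum1_size -big_split big_distrl big_distrr /=.
  rewrite big_seq [X in _ <= X]big_seq.
  apply: leq_sum => q qQ; rewrite -(coprodM qQ) mulnA mulnCA [y q * _]mulnC mulnA.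
  rewrite [K * _]mulnC leq_mul2r; apply/orP; right; apply: ltnW.
  by rewrite addn1 [q * _]mulnC ltn_ceil // prime_gt0 // (allP Qpr).
have c1 : (K%:Z * S%:Z = K%:Z * X + K%:Z * r%:Z * P%:Z)%R.
  by rewrite Sr er mulrDr mulrA.
have K0 : 0 < K by lia.
have c2 : (4 * (K%:Z * X) < K%:Z * P%:Z)%R by rewrite mulrCA ltr_pM2l //; lia.
have c3 : (- (K%:Z * P%:Z) < 4 * (K%:Z * X))%R.
  by rewrite mulrCA -mulrN ltr_pM2l //; lia.
have main : 2 * r * K < 2 * R + K /\ 2 * R < 2 * r * K + K.
  split; rewrite -(ltn_pmul2r P0); nia.
by move=> r'; split=> [|->//]; nia.
Qed.

(** In 'F_p the cofactor P / q is P u_q, so S becomes P times a sum that involves only inverses of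
    single primes. *)
Lemma crt_mod p (u : nat -> nat) : prime p -> p \notin Q ->
  {in Q, forall q, u q * q = 1 %[mod p]} ->
  forall r : nat, (S%:Z = X + (r * P)%:Z)%R ->
  (P%:R * ((\sum_(q <- Q) y q * u q)%:R - r%:R) = X%:~R :> 'F_p)%R.
Proof.
move=> p_pr pQ Hu r ES; rewrite mulrBr -!natrM.
have -> : ((P * \sum_(q <- Q) y q * u q)%:R = S%:R :> 'F_p)%R.
  rewrite big_distrr /= /S !natr_sum big_seq [RHS]big_seq; apply: eq_bigr => q qQ.
  rewrite -(coprodM qQ).
  have /(eq_modFp _ _ p_pr) := Hu q qQ; rewrite natrM => e.
  have {}e : ((u q)%:R * q%:R = 1 :> 'F_p)%R by [].
  rewrite !natrM; transitivity ((y q)%:R * (coprod q)%:R * ((u q)%:R * q%:R) : 'F_p)%R.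
    by ring.
  by rewrite e mulr1.
have := congr1 (fun z : int => (z%:~R : 'F_p)%R) ES.
by rewrite /= rmorphD /= -!pmulrn => ->; rewrite mulnC addrK.
Qed.
End CRT.

(** Each of the k! <= k^k terms of the Leibniz expansion is at most b^k in absolute value. *)
Lemma det_int_bound k (B : 'M[int]_k) b :
  (forall i j, `|B i j| <= b%:Z)%R -> (`|\det B| <= (k ^ k * b ^ k)%:Z)%R.
Proof.
move=> Bb; rewrite /determinant; apply: le_trans (ler_norm_sum _ _ _) _.
apply: (@le_trans _ _ (\sum_(s : 'S_k) (b ^ k)%:Z)%R).
  apply: ler_sum => s _; rewrite normrM normrX normrN1 expr1n mul1r normr_prod.
  have -> : ((b ^ k)%:Z = \prod_(i < k) b%:Z)%R.
    by rewrite prodr_const card_ord -[Posz b]natz -natrX natz.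
  by apply: ler_prod => i _; rewrite normr_ge0 Bb.
rewrite sumr_const card_Sn -mulr_natr natz -PoszM mulnC lez_nat leq_mul2r.
apply/orP; right; rewrite fact_prod.
apply: (@leq_trans (\prod_(1 <= i < k.+1) k)); last by rewrite prod_nat_const_nat subn1.
rewrite big_nat_cond [X in _ <= X]big_nat_cond.
by apply: leq_prod => i; rewrite andbT ltnS => /andP[].
Qed.

(** * Definability over the domain *)

Section Rename.
Variable d : nat.

Fixpoint frename (V W : Type) (r : V -> W) (f : formula d V) : formula d W :=
  match f with
  | fEq x y => fEq d (r x) (r y)
  | fLe x y => fLe d (r x) (r y)
  | fAdd x y z => fAdd d (r x) (r y) (r z)
  | fMul x y z => fMul d (r x) (r y) (r z)
  | fMat a b c => fMat (map_tuple r a) (map_tuple r b) (map_tuple r c)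
  | fNot f => fNot (frename r f)
  | fAnd f g => fAnd (frename r f) (frename r g)
  | fOr f g => fOr (frename r f) (frename r g)
  | fEx f => fEx (frename (omap r) f)
  | fAll f => fAll (frename (omap r) f)
  end.

Lemma sat_frename n (M : d.-tuple 'I_n -> d.-tuple 'I_n -> d.-tuple 'I_n -> bool)
    V W (r : V -> W) (f : formula d V) (e : W -> 'I_n) :
  sat M e (frename r f) = sat M (fun v => e (r v)) f.
Proof.
elim: f W r e => //=.
- move=> {}V a b c W r e.
  have E (t : d.-tuple V) :
      map_tuple e (map_tuple r t) = map_tuple (fun v => e (r v)) t.
    by apply: val_inj; rewrite /= -map_comp.
  by rewrite !E.
- by move=> {}V f IH W r e; rewrite IH.
- by move=> {}V f IHf g IHg W r e; rewrite IHf IHg.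
- by move=> {}V f IHf g IHg W r e; rewrite IHf IHg.
- move=> {}V f IH W r e; apply: eq_existsb => a; rewrite IH; congr sat.
  by apply: funext => -[].
- move=> {}V f IH W r e; apply: eq_forallb => a; rewrite IH; congr sat.
  by apply: funext => -[].
Qed.

Definition env_sum (T V W : Type) (e : V -> T) (f : W -> T) (s : V + W) : T :=
  match s with inl v => e v | inr w => f w end.

Lemma exists_block c V (phi : formula d (V + 'I_c)) :
  exists psi : formula d V, forall n
    (M : d.-tuple 'I_n -> d.-tuple 'I_n -> d.-tuple 'I_n -> bool) e,
    sat M e psi <-> exists f, sat M (env_sum e f) phi.
Proof.
elim: c V phi => [|c IH] V phi.
  exists (frename (fun s : V + 'I_0 => match s with inl v => v
     | inr i => match notF (ltn_ord i) with end end) phi) => n M e.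
  rewrite sat_frename; split=> [h|[f h]].
    exists (fun i : 'I_0 => match notF (ltn_ord i) with end).
    by move: h; congr (is_true (sat _ _ _)); apply: funext => -[v|[]].
  by move: h; congr (is_true (sat _ _ _)); apply: funext => -[v|[]].
pose r (s : V + 'I_c.+1) : option V + 'I_c := match s with
  | inl v => inl (Some v)
  | inr i => if unlift ord0 i is Some j then inr j else inl None end.
have [psi Hpsi] := IH _ (frename r phi).
exists (fEx psi) => n M e; split=> /=.
  case/existsP=> a /Hpsi[f]; rewrite sat_frename => h.
  exists (fun i => if unlift ord0 i is Some j then f j else a).
  move: h; congr (is_true (sat _ _ _)); apply: funext => -[v|i] //=.
  by case: unlift.
case=> f h; apply/existsP; exists (f ord0); apply/Hpsi.
exists (fun i => f (lift ord0 i)); rewrite sat_frename.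
move: h; congr (is_true (sat _ _ _)); apply: funext => -[v|i] //=.
by case: unliftP => [j|] ->.
Qed.
End Rename.

(** The counterpart of [tuple_num] for functions, since a block of c quantified variables is
    evaluated as a function on 'I_c. *)
Definition num n c (f : 'I_c -> 'I_n) : nat := \sum_(i < c) f i * n ^ i.

Lemma num_lt n c (f : 'I_c -> 'I_n) : num f < n ^ c.
Proof.
rewrite /num; elim: c f => [|c IH] f; first by rewrite big_ord0.
rewrite big_ord_recr /= expnS.
have := IH (fun i => f (widen_ord (leqnSn c) i)); have := ltn_ord (f ord_max).
move: (n ^ c) (\sum_(_ < _) _) (nat_of_ord (f ord_max)) => a b x; nia.
Qed.

Lemma num_recl n c (f : 'I_c.+1 -> 'I_n) :
  num f = f ord0 + n * num (fun i => f (lift ord0 i)).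
Proof.
rewrite /num big_ord_recl muln1 big_distrr; congr (_ + _).
by apply: eq_bigr => i _; rewrite /= expnS mulnCA.
Qed.

Lemma num_surj n c x : x < n ^ c -> exists f : 'I_c -> 'I_n, num f = x.
Proof.
elim: c x => [|c IH] x.
  rewrite expn0 ltnS leqn0 => /eqP->.
  by exists (fun i : 'I_0 => match notF (ltn_ord i) with end); rewrite /num big_ord0.
case: n IH => [|n] IH; first by rewrite exp0n.
rewrite expnS mulnC -ltn_divLR // => /IH[f ef].
have lt : x %% n.+1 < n.+1 by rewrite ltn_mod.
exists (fun i => if unlift ord0 i is Some j then f j else Ordinal lt).
rewrite num_recl unlift_none /=.
have -> : num (fun i => if unlift ord0 (lift ord0 i) is Some j then f j
    else Ordinal lt) = num f.
  by apply: eq_bigr => i _; rewrite liftK.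
by rewrite ef addnC mulnC -divn_eq.
Qed.

(** * Definability by one formula in all large structures of a family *)

Section Level0.
Variables (d : nat) (I : Type) (sz : I -> nat).
Variable M : forall i, d.-tuple 'I_(sz i) -> d.-tuple 'I_(sz i) ->
  d.-tuple 'I_(sz i) -> bool.

(** The index i will stand for domain size, prime and matrix together, so one formula has to serve
    all of them. Domains below [n0] are exempt, as they are handled by tables. *)
Definition FODef (V : Type) (P : forall i, (V -> 'I_(sz i)) -> Prop) : Prop :=
  exists (phi : formula d V) (n0 : nat), forall i, n0 <= sz i ->
    forall e, sat (@M i) e phi <-> P i e.

Lemma FODef_large n0 V (P Q : forall i, (V -> 'I_(sz i)) -> Prop) :
  (forall i e, n0 <= sz i -> P i e <-> Q i e) -> FODef Q -> FODef P.
Proof.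
move=> PQ [phi [n1 H]]; exists phi, (maxn n0 n1) => i.
by rewrite geq_max => /andP[h0 h1] e; rewrite H // -PQ.
Qed.

Lemma FODef_iff V (P Q : forall i, (V -> 'I_(sz i)) -> Prop) :
  (forall i e, P i e <-> Q i e) -> FODef Q -> FODef P.
Proof. by move=> PQ; apply: (@FODef_large 0) => i e _. Qed.

Lemma FODef_eq V (x y : V) : FODef (fun i e => e x = e y :> nat).
Proof.
by exists (fEq d x y), 0 => i _ e /=; split=> [/eqP->//|/val_inj->].
Qed.

Lemma FODef_le V (x y : V) : FODef (fun i e => e x <= e y).
Proof. by exists (fLe d x y), 0. Qed.

Lemma FODef_add V (x y z : V) : FODef (fun i e => e x + e y = e z).
Proof. by exists (fAdd d x y z), 0 => i _ e /=; split=> /eqP. Qed.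

Lemma FODef_mul V (x y z : V) : FODef (fun i e => e x * e y = e z).
Proof. by exists (fMul d x y z), 0 => i _ e /=; split=> /eqP. Qed.

Lemma FODef_mat V (x y z : d.-tuple V) :
  FODef (fun i e => M (map_tuple e x) (map_tuple e y) (map_tuple e z)).
Proof. by exists (fMat x y z), 0. Qed.

Lemma FODef_not V (P : forall i, (V -> 'I_(sz i)) -> Prop) :
  FODef P -> FODef (fun i e => ~ P i e).
Proof.
case=> phi [n0 H]; exists (fNot phi), n0 => i hi e /=.
by rewrite -H //; split=> /negP.
Qed.

Lemma FODef_and V (P Q : forall i, (V -> 'I_(sz i)) -> Prop) :
  FODef P -> FODef Q -> FODef (fun i e => P i e /\ Q i e).
Proof.
case=> phi [n0 H] [psi [n1 K]]; exists (fAnd phi psi), (maxn n0 n1) => i.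
by rewrite geq_max => /andP[h0 h1] e /=; rewrite -H // -K //; split=> /andP.
Qed.

Lemma FODef_or V (P Q : forall i, (V -> 'I_(sz i)) -> Prop) :
  FODef P -> FODef Q -> FODef (fun i e => P i e \/ Q i e).
Proof.
case=> phi [n0 H] [psi [n1 K]]; exists (fOr phi psi), (maxn n0 n1) => i.
by rewrite geq_max => /andP[h0 h1] e /=; rewrite -H // -K //; split=> /orP.
Qed.

Lemma FODef_imp V (P Q : forall i, (V -> 'I_(sz i)) -> Prop) :
  FODef P -> FODef Q -> FODef (fun i e => P i e -> Q i e).
Proof.
case=> phi [n0 H] [psi [n1 K]]; exists (fOr (fNot phi) psi), (maxn n0 n1) => i.
rewrite geq_max => /andP[h0 h1] e /=; rewrite -H // -K // -implybE.
by split=> /implyP.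
Qed.

Lemma FODef_ex V (P : forall i, (V -> 'I_(sz i)) -> 'I_(sz i) -> Prop) :
  FODef (fun i (e : option V -> _) => P i (fun v => e (Some v)) (e None)) ->
  FODef (fun i e => exists a, P i e a).
Proof.
case=> phi [n0 H]; exists (fEx phi), n0 => i hi e /=; split.
  by case/existsP=> a /H -/(_ hi); exists a.
by case=> a Pa; apply/existsP; exists a; apply/H.
Qed.

Lemma FODef_all V (P : forall i, (V -> 'I_(sz i)) -> 'I_(sz i) -> Prop) :
  FODef (fun i (e : option V -> _) => P i (fun v => e (Some v)) (e None)) ->
  FODef (fun i e => forall a, P i e a).
Proof.
case=> phi [n0 H]; exists (fAll phi), n0 => i hi e /=; split.
  by move/forallP=> h a; have /H -/(_ hi) := h a.
by move=> h; apply/forallP => a; apply/H => //=; apply: h.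
Qed.

Lemma FODef_rename V W (r : V -> W) (P : forall i, (V -> 'I_(sz i)) -> Prop) :
  FODef P -> FODef (fun i e => P i (fun v => e (r v))).
Proof.
by case=> phi [n0 H]; exists (frename r phi), n0 => i hi e; rewrite sat_frename H.
Qed.

Lemma FODef_exs c V (P : forall i, (V -> 'I_(sz i)) -> ('I_c -> 'I_(sz i)) -> Prop) :
  FODef (fun i (e : V + 'I_c -> _) =>
        P i (fun v => e (inl v)) (fun j => e (inr j))) ->
  FODef (fun i e => exists f, P i e f).
Proof.
case=> phi [n0 H]; have [psi Hpsi] := exists_block phi.
exists psi, n0 => i hi e; rewrite Hpsi; split=> -[f].
  by rewrite H // => h; exists f.
by move=> h; exists f; apply/H.
Qed.

(* Arithmetic on numbers that do not fit into the domain is done modulo the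
   m with m * m < sz i: products of residues do not leave the domain. *)
Definition ResDef W (t : forall i, (W -> 'I_(sz i)) -> nat) : Prop :=
  forall X (r : W -> X) (m x : X), FODef (fun i e =>
    (0 < e m /\ e m * e m < sz i) /\
    nat_of_ord (e x) = t i (fun w => e (r w)) %% e m).

Lemma ord_of n x : x < n -> exists a : 'I_n, a = x :> nat.
Proof. by move=> h; exists (Ordinal h). Qed.

Lemma ResDef_ext W (t u : forall i, (W -> 'I_(sz i)) -> nat) :
  (forall i e, t i e = u i e) -> ResDef t -> ResDef u.
Proof.
by move=> E H X r m x; apply: FODef_iff (H X r m x) => i e; rewrite E.
Qed.

Lemma FODef_modn X (m u x : X) :
  FODef (fun i e => 0 < e m /\ nat_of_ord (e x) = e u %% e m).
Proof.
apply: (@FODef_iff _ _ (fun i e => exists z y : 'I_(sz i), z * e m = y /\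
   y + e x = e u /\ ~ e m <= e x)) => [i e|]; last first.
  apply: FODef_ex; apply: FODef_ex; apply: FODef_and; first exact: (FODef_mul (Some None) (Some (Some m)) None).
  apply: FODef_and; first exact: (FODef_add None (Some (Some x)) (Some (Some u))).
  by apply: FODef_not; apply: (FODef_le (Some (Some m)) (Some (Some x))).
split=> [[m0 ex]|[z [y [<- [<- /negP]]]]]; last first.
  by rewrite -ltnNge => lt; rewrite modnMDl modn_small // (leq_ltn_trans _ lt).
have [z ez] := ord_of (leq_ltn_trans (leq_div (e u) (e m)) (ltn_ord (e u))).
have [y ey] := ord_of (leq_ltn_trans (leq_divM (e u) (e m)) (ltn_ord (e u))).
exists z, y; rewrite ez ey ex -divn_eq; split=> //; split=> //.
by apply/negP; rewrite -ltnNge ltn_mod.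
Qed.

Lemma FODef_one X (x : X) : FODef (fun i e => nat_of_ord (e x) = 1).
Proof.
apply: (@FODef_iff _ _ (fun i e => e x * e x = e x /\ ~ e x + e x = e x)) => [i e|]; last first.
  apply: FODef_and; first exact: (FODef_mul x x x).
  by apply: FODef_not; apply: (FODef_add x x x).
by move: (nat_of_ord (e x)) => n; split; nia.
Qed.

(** Both operands are reduced modulo m before [op] is applied. The result is then at most m^2 < n,
    hence an element of the domain, whose remainder can be taken. *)
Lemma ResDef_op (op : nat -> nat -> nat) W (t u : forall i, (W -> 'I_(sz i)) -> nat) :
  (forall X (x y z : X), FODef (fun i e => op (e x) (e y) = e z)) ->
  (forall a b m, op (a %% m) (b %% m) %% m = op a b %% m) ->
  (forall a b m, a < m -> b < m -> op a b <= m * m) ->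
  ResDef t -> ResDef u -> ResDef (fun i e => op (t i e) (u i e)).
Proof.
move=> Dop opm opb Dt Du X r m x.
apply: (@FODef_iff _ _ (fun i e => exists a b c : 'I_(sz i),
   ((0 < e m /\ e m * e m < sz i) /\ nat_of_ord a = t i (fun w => e (r w)) %% e m)
   /\ ((0 < e m /\ e m * e m < sz i) /\ nat_of_ord b = u i (fun w => e (r w)) %% e m)
   /\ op a b = c /\ 0 < e m /\ nat_of_ord (e x) = c %% e m)) => [i e|]; last first.
  apply: FODef_ex; apply: FODef_ex; apply: FODef_ex; apply: FODef_and.
    exact: (Dt _ (fun w => Some (Some (Some (r w)))) (Some (Some (Some m))) (Some (Some None))).
  apply: FODef_and.
    exact: (Du _ (fun w => Some (Some (Some (r w)))) (Some (Some (Some m))) (Some None)).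
  apply: FODef_and; first exact: (Dop _ (Some (Some None)) (Some None) None).
  exact: (FODef_modn (Some (Some (Some m))) None (Some (Some (Some x)))).
split=> [[[m0 mm] ->]|[a [b [c [[G ea] [[_ eb] [ec [m0 ex]]]]]]]]; last first.
  by split=> //; rewrite ex -ec ea eb opm.
have lt y : y %% e m < e m by rewrite ltn_mod.
have ltm y : y %% e m < sz i by apply: ltn_trans (lt y) (ltn_ord _).
have [a ea] := ord_of (ltm (t i (fun w => e (r w)))).
have [b eb] := ord_of (ltm (u i (fun w => e (r w)))).
have [c ec] : exists c : 'I_(sz i), c = op a b :> nat.
  by apply: ord_of; apply: leq_ltn_trans mm; apply: opb; rewrite ?ea ?eb.
by exists a, b, c; rewrite ec ea eb opm.
Qed.

Lemma ResDef_add W (t u : forall i, (W -> 'I_(sz i)) -> nat) :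
  ResDef t -> ResDef u -> ResDef (fun i e => t i e + u i e).
Proof.
apply: ResDef_op; [exact: FODef_add|by move=> *; rewrite modnDm|by move=> *; nia].
Qed.

Lemma ResDef_mul W (t u : forall i, (W -> 'I_(sz i)) -> nat) :
  ResDef t -> ResDef u -> ResDef (fun i e => t i e * u i e).
Proof.
apply: ResDef_op; [exact: FODef_mul|by move=> *; rewrite modnMm|].
by move=> a b m lta ltb; apply: leq_mul; apply: ltnW.
Qed.

Lemma ResDef_graph W (t : forall i, (W -> 'I_(sz i)) -> nat) :
  (forall X (r : W -> X) (x : X), FODef (fun i e => nat_of_ord (e x) = t i (fun w => e (r w)))) ->
  (exists n0, forall i e, n0 <= sz i -> t i e < sz i) -> ResDef t.
Proof.
move=> Dt [n0 tb] X r m x.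
apply: (@FODef_large n0 _ _ (fun i e => exists y b : 'I_(sz i),
   nat_of_ord y = t i (fun w => e (r w)) /\ e m * e m = b /\
   0 < e m /\ nat_of_ord (e x) = y %% e m)) => [i e hn|]; last first.
  apply: FODef_ex; apply: FODef_ex; apply: FODef_and.
    exact: (Dt _ (fun w => Some (Some (r w))) (Some None)).
  apply: FODef_and; first exact: (FODef_mul (Some (Some m)) (Some (Some m)) None).
  exact: (FODef_modn (Some (Some m)) (Some None) (Some (Some x))).
split=> [[[m0 mm] ->]|[a [b [<- [eb [m0 ex]]]]]]; last first.
  by rewrite eb.
have [y ey] := ord_of (tb i (fun w => e (r w)) hn).
by have [b eb] := ord_of mm; exists y, b; rewrite ey eb.
Qed.

Lemma ResDef_var W (w : W) : ResDef (fun i e => nat_of_ord (e w)).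
Proof.
apply: ResDef_graph => [X r x|]; first exact: (FODef_eq x (r w)).
by exists 0 => i e _.
Qed.

Lemma ResDef_one W : ResDef (fun i (e : W -> 'I_(sz i)) => 1).
Proof. by apply: ResDef_graph => [X r x|]; [exact: FODef_one|exists 2]. Qed.

Lemma ResDef_zero W : ResDef (fun i (e : W -> 'I_(sz i)) => 0).
Proof.
apply: ResDef_graph => [X r x|]; last by exists 1.
apply: (@FODef_iff _ _ (fun i e => e x + e x = e x)); last exact: FODef_add.
by move=> i e; lia.
Qed.

Lemma ResDef_const W c : ResDef (fun i (e : W -> 'I_(sz i)) => c).
Proof.
elim: c => [|c IH]; first exact: ResDef_zero.
by apply: (ResDef_ext _ (ResDef_add (@ResDef_one W) IH)) => i e.
Qed.

(** The domain has no element n, but n - 1 is its largest element, and the residues of n are those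
    of (n - 1) + 1. *)
Lemma ResDef_size W : ResDef (fun i (e : W -> 'I_(sz i)) => sz i).
Proof.
have H : ResDef (fun i (e : W -> 'I_(sz i)) => (sz i).-1).
  apply: ResDef_graph => [X r x|]; last by exists 1 => i e; case: (sz i).
  apply: (@FODef_iff _ _ (fun i e => forall y : 'I_(sz i), y <= e x)) => [i e|]; last first.
    by apply: FODef_all; apply: (FODef_le None (Some x)).
  have sz0 : 0 < sz i by apply: leq_ltn_trans (ltn_ord (e x)).
  split=> [-> y|h]; first by rewrite -ltnS prednK.
  have lt : (sz i).-1 < sz i by rewrite prednK.
  have := h (Ordinal lt); have := ltn_ord (e x); rewrite /=; lia.
move=> X r m x; apply: FODef_iff (ResDef_add H (@ResDef_one W) r m x) => i e.
by rewrite addn1 prednK // (leq_ltn_trans _ (ltn_ord (e x))).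
Qed.

Lemma ResDef_exp W (t : forall i, (W -> 'I_(sz i)) -> nat) c :
  ResDef t -> ResDef (fun i e => t i e ^ c).
Proof.
move=> Dt; elim: c => [|c IH]; first exact: ResDef_const.
by apply: (ResDef_ext _ (ResDef_mul Dt IH)) => i e; rewrite expnS.
Qed.

Lemma ResDef_num W c (w : 'I_c -> W) :
  ResDef (fun i e => num (fun j => e (w j)) : nat).
Proof.
elim: c w => [|c IH] w.
  by apply: (ResDef_ext _ (@ResDef_const W 0)) => i e; rewrite /num big_ord0.
apply: (ResDef_ext _ (ResDef_add (ResDef_var (w ord0))
  (ResDef_mul (@ResDef_size W) (IH (fun j => w (lift ord0 j)))))) => i e.
by rewrite num_recl.
Qed.

Lemma FODef_eqRD W c (t u : forall i, (W -> 'I_(sz i)) -> nat) :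
  ResDef t -> ResDef u -> (exists n0, forall i e, n0 <= sz i -> t i e < sz i ^ c) ->
  (exists n0, forall i e, n0 <= sz i -> u i e < sz i ^ c) ->
  FODef (fun i e => t i e = u i e).
Proof.
move=> Dt Du [n0 tb] [n1 ub]; have [n2 room] := sqrt_exp_room c.
(* That m * m is a domain element [b] says m^2 < n, and [~ m + m = m] says m > 0. *)
apply: (@FODef_large (maxn n0 (maxn n1 n2)) _ _ (fun i e => forall m : 'I_(sz i),
  (exists b : 'I_(sz i), m * m = b /\ ~ m + m = m) -> exists a : 'I_(sz i),
  ((0 < m /\ m * m < sz i) /\ nat_of_ord a = t i e %% m) /\
  ((0 < m /\ m * m < sz i) /\ nat_of_ord a = u i e %% m))) => [i e|]; last first.
  apply: FODef_all; apply: FODef_imp.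
    apply: FODef_ex; apply: FODef_and; first exact: (FODef_mul (Some None) (Some None) None).
    by apply: FODef_not; apply: (FODef_add (Some None) (Some None) (Some None)).
  apply: FODef_ex; apply: FODef_and.
    exact: (Dt _ (fun w => Some (Some w)) (Some None) None).
  exact: (Du _ (fun w => Some (Some w)) (Some None) None).
rewrite !geq_max => /and3P[h0 h1 h2]; split=> [E m [b [eb em]]|H].
  have m0 : 0 < m by lia.
  have lt : t i e %% m < sz i by apply: ltn_trans (ltn_ord m); rewrite ltn_mod.
  by exists (Ordinal lt); rewrite eb -E.
have [j j1 j2] := room _ h2.
apply: (@eq_mod_small j); [exact: leq_trans (tb i e h0) j2|exact: leq_trans (ub i e h1) j2|].
move=> m /andP[m0 mj].
have mm : m * m < sz i by apply: leq_ltn_trans j1; apply: leq_mul.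
have lt : m < sz i by apply: leq_ltn_trans mm; rewrite leq_pmulr.
have [|a [[_ <-] [_ <-]]] // := H (Ordinal lt).
by exists (Ordinal mm); split=> //=; lia.
Qed.

(** Residues do not show the order directly, so t <= u is expressed by guessing the difference; the
    sum t + [num f] costs one more digit in the bound. *)
Lemma FODef_leRD W c (t u : forall i, (W -> 'I_(sz i)) -> nat) :
  ResDef t -> ResDef u -> (exists n0, forall i e, n0 <= sz i -> t i e < sz i ^ c) ->
  (exists n0, forall i e, n0 <= sz i -> u i e < sz i ^ c) ->
  FODef (fun i e => t i e <= u i e).
Proof.
move=> Dt Du [n0 tb] [n1 ub].
apply: (@FODef_large (maxn 2 (maxn n0 n1)) _ _ (fun i e => exists f : 'I_c -> 'I_(sz i),
   t i e + num f = u i e)) => [i e|].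
  rewrite !geq_max => /and3P[h2 h0 h1]; split=> [le|[f <-]]; last exact: leq_addr.
  have [f ef] := num_surj (leq_ltn_trans (leq_subr (t i e) _) (ub i e h1)).
  by exists f; rewrite ef subnKC.
apply: FODef_exs.
have RDl (v : forall i, (W -> 'I_(sz i)) -> nat) : ResDef v ->
    ResDef (fun i (e : W + 'I_c -> _) => v i (fun w => e (inl w))).
  by move=> Dv X r m x; apply: (Dv X (fun w => r (inl w))).
apply: (@FODef_eqRD _ c.+1); first (by apply: ResDef_add; [exact: RDl|exact: ResDef_num]).
- exact: RDl.
- exists (maxn 2 n0) => i e; rewrite !geq_max => /andP[h2 h0].
  have := tb i (fun w => e (inl w)) h0; have := num_lt (fun j : 'I_c => e (inr j)).
  by rewrite expnS; nia.
exists (maxn 2 n1) => i e; rewrite !geq_max => /andP[h2 h0].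
have := ub i (fun w => e (inl w)) h0; rewrite expnS; nia.
Qed.
End Level0.

(** * Definability of numbers below n^D *)

Section Level1.
Variables (d : nat) (I : Type) (sz : I -> nat).
Variable M : forall i, d.-tuple 'I_(sz i) -> d.-tuple 'I_(sz i) ->
  d.-tuple 'I_(sz i) -> bool.
Variable D : nat.

(** A number variable v is a block of domain variables (v, 0), ..., (v, D - 1) holding its digits in
    base n. *)
Definition decode V i (e : V * 'I_D -> 'I_(sz i)) (v : V) : nat :=
  num (fun j => e (v, j)).

Definition num_definable (V : Type) (P : I -> (V -> nat) -> Prop) : Prop :=
  FODef M (fun i (e : V * 'I_D -> 'I_(sz i)) => P i (decode e)).

(** Values may exceed n^D: a term is accessed through its residues only, and any exponent c of its
    own suffices for comparing it. *)
Definition poly_term (V : Type) (t : I -> (V -> nat) -> nat) : Prop :=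
  ResDef M (fun i (e : V * 'I_D -> 'I_(sz i)) => t i (decode e)) /\
  exists c, forall i (e : V -> nat),
    1 < sz i -> (forall v, e v < sz i ^ D) -> t i e < sz i ^ c.

Lemma PolyTerm_var V (v : V) : poly_term (fun i e => e v).
Proof.
split; last by exists D => i e _ h; exact: h.
exact: (ResDef_num M (fun j : 'I_D => (v, j))).
Qed.

Lemma PolyTerm_const V c : poly_term (fun i (e : V -> nat) => c).
Proof.
split; first exact: ResDef_const.
exists c => i e h _; apply: ltn_expl; exact: h.
Qed.

Lemma PolyTerm_add V (t u : I -> (V -> nat) -> nat) :
  poly_term t -> poly_term u -> poly_term (fun i e => t i e + u i e).
Proof.
move=> [Dt [a ta]] [Du [b ub]]; split; first exact: ResDef_add.
exists (a + b).+1 => i e h1 he; have := ta i e h1 he; have := ub i e h1 he.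
rewrite expnS expnD => lu lt; apply: (@leq_trans (2 * (sz i ^ a * sz i ^ b))).
  by move: lu lt; move: (_ ^ a) (_ ^ b) => x y; nia.
by rewrite leq_mul2r h1 orbT.
Qed.

Lemma PolyTerm_mul V (t u : I -> (V -> nat) -> nat) :
  poly_term t -> poly_term u -> poly_term (fun i e => t i e * u i e).
Proof.
move=> [Dt [a ta]] [Du [b ub]]; split; first exact: ResDef_mul.
exists (a + b) => i e h1 he; have := ta i e h1 he; have := ub i e h1 he.
rewrite expnD; move: (_ ^ a) (_ ^ b) => x y; nia.
Qed.

Lemma PolyTerm_succ V (t : I -> (V -> nat) -> nat) :
  poly_term t -> poly_term (fun i e => (t i e).+1).
Proof.
move=> Dt; have [Ds [c sc]] := PolyTerm_add (PolyTerm_const V 1) Dt; split.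
  by apply: ResDef_ext Ds => i e; rewrite add1n.
by exists c => i e h1 he; rewrite -add1n sc.
Qed.

Lemma PolyTerm_exp V (t : I -> (V -> nat) -> nat) c :
  poly_term t -> poly_term (fun i e => t i e ^ c).
Proof.
move=> [Dt [a ta]]; split; first exact: ResDef_exp.
exists (a * c).+1 => i e h1 he; rewrite expnS expnM.
have : t i e ^ c <= (sz i ^ a) ^ c.
  by case: c => [|c] //; rewrite leq_exp2r // ltnW // ta.
have : 0 < (sz i ^ a) ^ c by rewrite !expn_gt0 (ltnW h1).
by move: (_ ^ c) (_ ^ c) => x y; nia.
Qed.

Lemma PolyTerm_weak V W (r : V -> W) (t : I -> (V -> nat) -> nat) :
  poly_term t -> poly_term (fun i e => t i (fun v => e (r v))).
Proof.
move=> [Dt [c tc]]; split; last by exists c => i e h1 he; apply: tc.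
move=> X q m x; exact: (Dt X (fun w => q (r w.1, w.2)) m x).
Qed.

Lemma NumDef_not V (P : I -> (V -> nat) -> Prop) : num_definable P -> num_definable (fun i e => ~ P i e).
Proof. exact: FODef_not. Qed.

Lemma NumDef_and V (P Q : I -> (V -> nat) -> Prop) :
  num_definable P -> num_definable Q -> num_definable (fun i e => P i e /\ Q i e).
Proof. exact: FODef_and. Qed.

Lemma NumDef_or V (P Q : I -> (V -> nat) -> Prop) :
  num_definable P -> num_definable Q -> num_definable (fun i e => P i e \/ Q i e).
Proof. exact: FODef_or. Qed.

Lemma NumDef_imp V (P Q : I -> (V -> nat) -> Prop) :
  num_definable P -> num_definable Q -> num_definable (fun i e => P i e -> Q i e).
Proof. exact: FODef_imp. Qed.

(** With these bounded quantifiers, taken at N = n^D, the relations below are ordinary propositions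
    about numbers, so that their meaning and their definability are proved separately. *)
Definition exB (N : nat) (P : nat -> Prop) : Prop := exists x, x < N /\ P x.
Definition allB (N : nat) (P : nat -> Prop) : Prop := forall x, x < N -> P x.

Lemma NumDef_exB V (P : I -> (V -> nat) -> nat -> Prop) :
  num_definable (fun i (e : option V -> nat) => P i (fun v => e (Some v)) (e None)) ->
  num_definable (fun i e => exB (sz i ^ D) (P i e)).
Proof.
move=> H.
apply: (@FODef_iff _ _ _ _ _ _ (fun i e => exists f : 'I_D -> 'I_(sz i),
  P i (decode e) (num f))) => [i e|].
  split=> [[x [/num_surj[f <-] h]]|[f h]]; first by exists f.
  by exists (num f); split=> //; exact: num_lt.
apply: FODef_exs.
exact: (FODef_rename (fun w : option V * 'I_D => if w.1 is Some v then inl (v, w.2)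
          else inr w.2) H).
Qed.

Lemma NumDef_allB V (P : I -> (V -> nat) -> nat -> Prop) :
  num_definable (fun i (e : option V -> nat) => P i (fun v => e (Some v)) (e None)) ->
  num_definable (fun i e => allB (sz i ^ D) (P i e)).
Proof.
(* The universal quantifier is reduced to the existential one; the double negation is removed
   through the Boolean truth value of [phi]. *)
move=> H; have [phi [n0 Hphi]] := H.
apply: (FODef_large (n0 := n0) _ (NumDef_not (NumDef_exB (P := fun i e x => ~ P i e x) (NumDef_not H)))) => i e hn.
split=> [h [x [xN Px]]|h x /num_surj[f ef]]; first by apply: Px; apply: h.
pose e' (w : option V * 'I_D) := if w.1 is Some v then e (v, w.2) else f w.2.
have := Hphi i hn e'; rewrite /decode /= -/(decode _) ef.
case: (sat _ _ _) => -[h1 h2]; first exact: h1.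
by case: h; exists x; split; [rewrite -ef; exact: num_lt|move=> /h2].
Qed.

Lemma NumDef_eq V (t u : I -> (V -> nat) -> nat) :
  poly_term t -> poly_term u -> num_definable (fun i e => t i e = u i e).
Proof.
move=> [Dt [a ta]] [Du [b ub]]; apply: (FODef_eqRD (c := a + b) Dt Du); exists 2 => i e h.
  apply: leq_trans (ta i _ h (fun v => num_lt _)) _.
  by rewrite leq_exp2l // leq_addr.
apply: leq_trans (ub i _ h (fun v => num_lt _)) _.
by rewrite leq_exp2l // leq_addl.
Qed.

Lemma NumDef_le V (t u : I -> (V -> nat) -> nat) :
  poly_term t -> poly_term u -> num_definable (fun i e => t i e <= u i e).
Proof.
move=> [Dt [a ta]] [Du [b ub]]; apply: (FODef_leRD (c := a + b) Dt Du); exists 2 => i e h.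
  apply: leq_trans (ta i _ h (fun v => num_lt _)) _.
  by rewrite leq_exp2l // leq_addr.
apply: leq_trans (ub i _ h (fun v => num_lt _)) _.
by rewrite leq_exp2l // leq_addl.
Qed.

Lemma NumDef_lt V (t u : I -> (V -> nat) -> nat) :
  poly_term t -> poly_term u -> num_definable (fun i e => t i e < u i e).
Proof. by move=> Dt Du; apply: NumDef_le => //; apply: PolyTerm_succ. Qed.

(** A number that is not below n^d is the value of no d-tuple, so it never occurs as a row, a column
    or an entry. *)
Definition matB i (x y z : nat) : Prop := exists r c v : d.-tuple 'I_(sz i),
  [/\ tuple_num r = x, tuple_num c = y, tuple_num v = z & M r c v].

Lemma NumDef_mat V (x y z : I -> (V -> nat) -> nat) : poly_term x -> poly_term y -> poly_term z ->
  num_definable (fun i e => matB i (x i e) (y i e) (z i e)).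
Proof.
move=> Dx Dy Dz.
have eqD W (t : I -> (V -> nat) -> nat) (k : V * 'I_D -> W) (w : 'I_d -> W) :
    poly_term t -> FODef M (fun i e =>
      num (fun j => e (w j)) = t i (decode (fun v => e (k v)))).
  move=> [Dt [c tc]]; apply: (FODef_eqRD (c := d + c)); first exact: ResDef_num.
  - by move=> X r m a; apply: (Dt X (fun v => r (k v))).
  - exists 1 => i e h; apply: leq_trans (num_lt _) _.
    by rewrite leq_pexp2l // leq_addr.
  exists 2 => i e h; apply: leq_trans (tc i _ h (fun v => num_lt _)) _.
  by rewrite leq_exp2l // leq_addl.
apply: (@FODef_iff _ _ _ _ _ _ (fun i e => exists r c v : 'I_d -> 'I_(sz i),
  num r = x i (decode e) /\ num c = y i (decode e) /\
  num v = z i (decode e) /\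
  M [tuple r j | j < d] [tuple c j | j < d] [tuple v j | j < d])) => [i e|].
  split=> [[r [c [v [er ec ev h]]]]|[r [c [v [er [ec [ev h]]]]]]].
    exists (tnth r), (tnth c), (tnth v); do 3!split=> //.
    have E (t : d.-tuple 'I_(sz i)) : [tuple tnth t j | j < d] = t.
      by apply: eq_from_tnth => j; rewrite tnth_mktuple.
    by rewrite !E.
  have E (f : 'I_d -> 'I_(sz i)) : tuple_num [tuple f j | j < d] = num f.
    by apply: eq_bigr => j _; rewrite tnth_mktuple.
  by exists [tuple r j | j < d], [tuple c j | j < d], [tuple v j | j < d]; split=> //; rewrite E.
apply: FODef_exs; apply: FODef_exs; apply: FODef_exs.
apply: FODef_and; first exact: (eqD _ _ (fun w => inl (inl (inl w))) (fun j => inl (inl (inr j))) Dx).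
apply: FODef_and; first exact: (eqD _ _ (fun w => inl (inl (inl w))) (fun j => inl (inr j)) Dy).
apply: FODef_and; first exact: (eqD _ _ (fun w => inl (inl (inl w))) (fun j => inr j) Dz).
have [phi [n0 H]] := FODef_mat M
  [tuple (inl (inl (inr j)) : (V * 'I_D + 'I_d + 'I_d + 'I_d)%type) | j < d]
  [tuple inl (inr j) | j < d] [tuple inr j | j < d].
exists phi, n0 => i hi e; rewrite H //.
have E T T' (f : T -> T') (g : 'I_d -> T) :
    map_tuple f [tuple g j | j < d] = [tuple f (g j) | j < d].
  by apply: eq_from_tnth => j; rewrite tnth_map !tnth_mktuple.
by rewrite !E.
Qed.
End Level1.

(** * The defining formula *)

Section Relations.
Variable N : nat.

Definition dvdB m x := exB N (fun z => x = z * m).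
Definition remB x m r := r < m /\ exB N (fun z => x = z * m + r).
Definition congB x y m := exB N (fun z => x = y + z * m \/ y = x + z * m).
Definition primeB q := 1 < q /\ allB N (fun m => dvdB m q -> m = 1 \/ m = q).

Variables k s : nat.

(* With s fixed, the i-th modulus is the least prime q > k^18 such that
   s mod q = i, and t encodes the vector of the t mod q.  Moduli below k^38 are
   available for all i <= k, so k + 1 entries bounded by k^18 are encoded by
   some t < k^(38 (k + 1)). *)
Definition slotB i q :=
  k ^ 18 < q /\ primeB q /\ remB s q i /\
  allB N (fun x => x < q /\ k ^ 18 < x /\ primeB x -> ~ remB s x i).

Definition entryB t i x := exB N (fun q => slotB i q /\ remB t q x).

(** A run of k steps whose k + 1 states are the entries of one guessed number t. The parameter x is
    the index of the block: steps are numbered x k + i, so that chains can be nested. *)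
Definition chainB (G : nat -> nat -> nat -> Prop) x a b :=
  exB N (fun t => entryB t 0 a /\ entryB t k b /\
    allB N (fun i => i < k -> exB N (fun y => exB N (fun c => exB N (fun c' =>
      y = x * k + i /\ entryB t i c /\ entryB t i.+1 c' /\ G y c c'))))).

(* From a to b by the k^n steps G y, y = x k^n, ..., (x + 1) k^n - 1. *)
Fixpoint iterB n G : nat -> nat -> nat -> Prop :=
  if n is n'.+1 then chainB (iterB n' G) else G.

Variable A : nat -> nat -> nat -> Prop.

Section ModQ.
Variable q : nat.
Definition matQ i j a := exB N (fun z => A i j z /\ remB z q a).

(* Entry (i, j) of W A modulo q, where row i of W A is row i of A plus the row
   given by entry i of l; that entry is k if nothing is added. *)
Definition wQ l i j a := exB N (fun h => entryB l i h /\
  (h = k /\ matQ i j a \/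
   (i < h /\ h < k) /\ exB N (fun a1 => exB N (fun a2 =>
      matQ i j a1 /\ matQ h j a2 /\ a = a1 + a2)))).

Definition dot_stepQ l y j x a b := exB N (fun u => exB N (fun w =>
  entryB y x u /\ wQ l x j w /\ b = a + u * w)).

(** The partial sums are not reduced modulo q, since they stay within the bound k^18 on coded
    entries anyway. *)
Definition dotQ l y j b := chainB (dot_stepQ l y j) 0 0 b.

(* y is row i of the unit lower triangular matrix L, and u the i-th pivot. *)
Definition rowQ l i y u :=
  allB N (fun m => m < k ->
    (m = i -> entryB y m 1) /\ (i < m -> entryB y m 0)) /\
  allB N (fun j => j < i -> exB N (fun x => dotQ l y j x /\ dvdB q x)) /\
  exB N (fun x => dotQ l y i x /\ congB x u q).

(** [l] codes the row additions and [c] the pivots. A row y of L is guessed only after i has been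
    fixed, because k^2 entries do not fit into one number. *)
Definition luQ x := exB N (fun l => exB N (fun c =>
  allB N (fun i => i < k ->
    exB N (fun u => exB N (fun y => entryB c i u /\ rowQ l i y u))) /\
  chainB (fun i a b => exB N (fun u => entryB c i u /\ remB (a * u) q b)) 0 1 x)).

Definition detQ x := luQ x \/ x = 0 /\ ~ exB N luQ.
End ModQ.

Variable p : nat.

Definition inQ x := primeB x /\ ~ x = p.

Definition cof_step q x a b :=
  (inQ x /\ ~ x = q) /\ remB (a * x) q b \/ ~ (inQ x /\ ~ x = q) /\ b = a.

(* The inverse modulo q of the product of the other primes. *)
Definition crt_weight q h :=
  h < q /\ exB N (fun c => iterB 8 (cof_step q) 0 1 c /\ congB (h * c) 1 q).

(** The numerator y_q of the fraction with denominator q in X / P. For X = 1 the numerator is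
    [crt_weight] itself. *)
Definition crt_digit q y := exB N (fun x => exB N (fun h =>
  detQ q x /\ crt_weight q h /\ remB (x * h) q y)).

Section Reconstruct.
Variable Y : nat -> nat -> Prop.

(** f is the floor of y K / x with K = 4 k^8 + 1. This scale exceeds four times the number of primes
    involved, so all the floors together lose less than K / 4. *)
Definition frac_step x a b :=
  inQ x /\ exB N (fun y => exB N (fun f => Y x y /\
    f * x <= y * (4 * k ^ 8 + 1) /\ y * (4 * k ^ 8 + 1) < f.+1 * x /\
    b = a + f)) \/
  ~ inQ x /\ b = a.

Definition rankB r := exB N (fun R => iterB 8 frac_step 0 0 R /\
  2 * r * (4 * k ^ 8 + 1) < 2 * R + (4 * k ^ 8 + 1) /\
  2 * R < 2 * r * (4 * k ^ 8 + 1) + (4 * k ^ 8 + 1)).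

(* u is the inverse of x modulo p. *)
Definition sum_step m x a b :=
  inQ x /\ exB N (fun y => exB N (fun u => exB N (fun g => Y x y /\ u < p /\
    congB (u * x) 1 p /\ remB (y * u) m g /\ b = a + g))) \/
  ~ inQ x /\ b = a.

(** The terms y u can be of size p k^8, too large to be states of a chain, whose entries are at most
    k^18. Only the sum of their residues modulo m is iterated. *)
Definition sumB x := allB N (fun m => 0 < m -> m < k ^ 8 ->
  exB N (fun r => iterB 8 (sum_step m) 0 0 r /\ congB r x m)).
End Reconstruct.

(* Modulo p, P (s1 - r1) = 1 and P (s2 - r2) = X, so this says v = X; it is
   written without subtraction. *)
Definition det_modB v := v < p /\
  exB N (fun r1 => exB N (fun r2 => exB N (fun s1 => exB N (fun s2 =>
    rankB crt_weight r1 /\ rankB crt_digit r2 /\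
    sumB crt_weight s1 /\ sumB crt_digit s2 /\
    congB (v * s1 + r2) (s2 + v * r1) p)))).
End Relations.

(* k is recognized as the least number that is not the index of a row. *)
Definition sizeB N (A : nat -> nat -> nat -> Prop) k :=
  allB N (fun i => i < k -> exB N (fun z => A i 0 z)) /\
  ~ exB N (fun z => A k 0 z).

Definition slotsB N k s :=
  allB N (fun i => i <= k -> exB N (fun q => q < k ^ 38 /\ slotB N k s i q)).

Definition det_defB N A p v := exB N (fun k => exB N (fun s =>
  sizeB N A k /\ slotsB N k s /\ det_modB N k s A p v)).

(** * Definability of the relations that make up the formula *)

Section Definable.
Variables (d : nat) (I : Type) (sz : I -> nat).
Variable M : forall i, d.-tuple 'I_(sz i) -> d.-tuple 'I_(sz i) ->
  d.-tuple 'I_(sz i) -> bool.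
Variable D : nat.
Notation NumDef := (num_definable M D).
Notation PolyTerm := (poly_term M D).
Opaque num_definable poly_term.
Notation N i := (sz i ^ D).
Notation A i := (@matB d I sz M i).
Notation term V := (I -> (V -> nat) -> nat).

Ltac poly := cbv beta; repeat first [ assumption | apply PolyTerm_var | apply PolyTerm_const
  | apply PolyTerm_succ | apply PolyTerm_add | apply PolyTerm_mul | apply PolyTerm_exp | apply PolyTerm_weak ].
(** Recursion on the syntax of a relation. [num_definable] and [poly_term] are opaque here, which
    keeps them from being unfolded into statements about domain variables. *)
Ltac numdef_with leaf := cbv beta; repeat lazymatch goal with
  | |- num_definable _ _ (fun i e => @?P i e /\ @?Q i e) => apply NumDef_and
  | |- num_definable _ _ (fun i e => @?P i e \/ @?Q i e) => apply NumDef_or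
  | |- num_definable _ _ (fun i e => ~ @?P i e) => apply NumDef_not
  | |- num_definable _ _ (fun i e => exB _ (@?P i e)) => apply NumDef_exB
  | |- num_definable _ _ (fun i e => allB _ (@?P i e)) => apply NumDef_allB
  | |- num_definable _ _ (fun i e => @?P i e -> @?Q i e) => apply NumDef_imp
  | |- num_definable _ _ (fun i e => is_true (_ < _)) => apply NumDef_lt
  | |- num_definable _ _ (fun i e => is_true (_ <= _)) => apply NumDef_le
  | |- num_definable _ _ (fun i e => _ = _) => apply NumDef_eq
  | |- num_definable _ _ (fun i e => @matB _ _ _ _ _ _ _ _) => apply NumDef_mat
  | |- num_definable _ _ _ => leaf
  end; poly.
Ltac numdef_core := numdef_with fail.

Lemma NumDef_dvdB V (m x : term V) : PolyTerm m -> PolyTerm x ->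
  NumDef (fun i e => dvdB (N i) (m i e) (x i e)).
Proof. by move=> Dm Dx; unfold dvdB; numdef_core. Qed.

Lemma NumDef_remB V (x m r : term V) : PolyTerm x -> PolyTerm m -> PolyTerm r ->
  NumDef (fun i e => remB (N i) (x i e) (m i e) (r i e)).
Proof. by move=> Dx Dm Dr; unfold remB; numdef_core. Qed.

Lemma NumDef_congB V (x y m : term V) : PolyTerm x -> PolyTerm y -> PolyTerm m ->
  NumDef (fun i e => congB (N i) (x i e) (y i e) (m i e)).
Proof. by move=> Dx Dy Dm; unfold congB; numdef_core. Qed.

Lemma NumDef_primeB V (q : term V) : PolyTerm q -> NumDef (fun i e => primeB (N i) (q i e)).
Proof.
by move=> Dq; unfold primeB; numdef_core; apply NumDef_dvdB; poly.
Qed.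

Lemma NumDef_slotB V (k s j q : term V) : PolyTerm k -> PolyTerm s -> PolyTerm j -> PolyTerm q ->
  NumDef (fun i e => slotB (N i) (k i e) (s i e) (j i e) (q i e)).
Proof.
move=> Dk Ds Dj Dq; unfold slotB; numdef_core; (apply NumDef_primeB || apply NumDef_remB); poly.
Qed.

Lemma NumDef_entryB V (k s t j x : term V) : PolyTerm k -> PolyTerm s -> PolyTerm t -> PolyTerm j -> PolyTerm x ->
  NumDef (fun i e => entryB (N i) (k i e) (s i e) (t i e) (j i e) (x i e)).
Proof.
move=> Dk Ds Dt Dj Dx; unfold entryB; numdef_core; (apply NumDef_slotB || apply NumDef_remB); poly.
Qed.

Ltac relation := idtac; lazymatch goal with
  | |- num_definable _ _ (fun i e => dvdB _ _ _) => apply NumDef_dvdB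
  | |- num_definable _ _ (fun i e => remB _ _ _ _) => apply NumDef_remB
  | |- num_definable _ _ (fun i e => congB _ _ _ _) => apply NumDef_congB
  | |- num_definable _ _ (fun i e => primeB _ _) => apply NumDef_primeB
  | |- num_definable _ _ (fun i e => slotB _ _ _ _ _) => apply NumDef_slotB
  | |- num_definable _ _ (fun i e => entryB _ _ _ _ _ _) => apply NumDef_entryB
  end.
Ltac numdef := numdef_with relation.

(** A relation passed as a parameter is applied to bound variables under further quantifiers;
    therefore definability is required after every renaming r of its free variables. *)
Definition RelDef3 V (G : I -> (V -> nat) -> nat -> nat -> nat -> Prop) :=
  forall W (r : V -> W) (x a b : W),
    NumDef (fun i e => G i (fun v => e (r v)) (e x) (e a) (e b)).

Lemma NumDef_chainB V (k s x a b : term V) G : RelDef3 G ->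
  PolyTerm k -> PolyTerm s -> PolyTerm x -> PolyTerm a -> PolyTerm b ->
  NumDef (fun i e => chainB (N i) (k i e) (s i e) (G i e) (x i e) (a i e) (b i e)).
Proof.
move=> DG Dk Ds Dx Da Db; unfold chainB; numdef.
apply: (DG _ (fun v => Some (Some (Some (Some (Some v)))))).
Qed.

Lemma RelDef3_iterB n V (k s : term V) G : RelDef3 G -> PolyTerm k -> PolyTerm s ->
  RelDef3 (fun i e => iterB (N i) (k i e) (s i e) n (G i e)).
Proof.
move=> DG Dk Ds; elim: n => [|n IH] //= W r x a b.
apply (NumDef_chainB (G := fun i (e : W -> nat) =>
   iterB (N i) (k i (fun v => e (r v))) (s i (fun v => e (r v))) n (G i (fun v => e (r v)))));
  poly.
by move=> X q x' a' b'; apply: (IH X (fun v => q (r v))).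
Qed.

(** With at least one level the arguments x, a and b may be terms, because the outermost chain
    applies its step relation to bound variables only. *)
Lemma NumDef_iterB n V (k s x a b : term V) G : RelDef3 G ->
  PolyTerm k -> PolyTerm s -> PolyTerm x -> PolyTerm a -> PolyTerm b ->
  NumDef (fun i e => iterB (N i) (k i e) (s i e) n.+1 (G i e) (x i e) (a i e) (b i e)).
Proof.
move=> DG Dk Ds Dx Da Db /=; apply NumDef_chainB => //.
by apply: RelDef3_iterB.
Qed.

Lemma NumDef_matQ V (q j l a : term V) : PolyTerm q -> PolyTerm j -> PolyTerm l -> PolyTerm a ->
  NumDef (fun i e => matQ (N i) (A i) (q i e) (j i e) (l i e) (a i e)).
Proof. by move=> *; unfold matQ; numdef. Qed.

Lemma NumDef_wQ V (k s q l j x a : term V) :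
  PolyTerm k -> PolyTerm s -> PolyTerm q -> PolyTerm l -> PolyTerm j -> PolyTerm x -> PolyTerm a ->
  NumDef (fun i e => wQ (N i) (k i e) (s i e) (A i) (q i e) (l i e) (j i e) (x i e) (a i e)).
Proof. by move=> *; unfold wQ; numdef; apply NumDef_matQ; poly. Qed.

Lemma NumDef_dotQ V (k s q l y j b : term V) :
  PolyTerm k -> PolyTerm s -> PolyTerm q -> PolyTerm l -> PolyTerm y -> PolyTerm j -> PolyTerm b ->
  NumDef (fun i e => dotQ (N i) (k i e) (s i e) (A i) (q i e) (l i e) (y i e) (j i e) (b i e)).
Proof.
move=> *; unfold dotQ; apply NumDef_chainB; poly.
by move=> W r x a c; unfold dot_stepQ; numdef; apply NumDef_wQ; poly.
Qed.

Lemma NumDef_rowQ V (k s q l j y u : term V) :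
  PolyTerm k -> PolyTerm s -> PolyTerm q -> PolyTerm l -> PolyTerm j -> PolyTerm y -> PolyTerm u ->
  NumDef (fun i e => rowQ (N i) (k i e) (s i e) (A i) (q i e) (l i e) (j i e) (y i e) (u i e)).
Proof.
move=> *; unfold rowQ; numdef; apply NumDef_dotQ; poly.
Qed.

Lemma NumDef_luQ V (k s q x : term V) : PolyTerm k -> PolyTerm s -> PolyTerm q -> PolyTerm x ->
  NumDef (fun i e => luQ (N i) (k i e) (s i e) (A i) (q i e) (x i e)).
Proof.
move=> *; unfold luQ; numdef; first by apply NumDef_rowQ; poly.
apply NumDef_chainB; poly.
by move=> W r a b c; numdef.
Qed.

Lemma NumDef_detQ V (k s q x : term V) : PolyTerm k -> PolyTerm s -> PolyTerm q -> PolyTerm x ->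
  NumDef (fun i e => detQ (N i) (k i e) (s i e) (A i) (q i e) (x i e)).
Proof. by move=> *; unfold detQ; numdef; apply NumDef_luQ; poly. Qed.

Lemma NumDef_inQ V (p x : term V) : PolyTerm p -> PolyTerm x ->
  NumDef (fun i e => inQ (N i) (p i e) (x i e)).
Proof. by move=> *; unfold inQ; numdef. Qed.

Definition RelDef2 V (Y : I -> (V -> nat) -> nat -> nat -> Prop) :=
  forall W (r : V -> W) (x y : W),
    NumDef (fun i e => Y i (fun v => e (r v)) (e x) (e y)).

Lemma NumDef_crt_weight V (k s p q h : term V) :
  PolyTerm k -> PolyTerm s -> PolyTerm p -> PolyTerm q -> PolyTerm h ->
  NumDef (fun i e => crt_weight (N i) (k i e) (s i e) (p i e) (q i e) (h i e)).
Proof.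
move=> *; unfold crt_weight; numdef; apply NumDef_iterB; poly.
by move=> W r x a b; unfold cof_step; numdef; apply NumDef_inQ; poly.
Qed.

Lemma NumDef_crt_digit V (k s p q y : term V) :
  PolyTerm k -> PolyTerm s -> PolyTerm p -> PolyTerm q -> PolyTerm y ->
  NumDef (fun i e => crt_digit (N i) (k i e) (s i e) (A i) (p i e) (q i e) (y i e)).
Proof.
by move=> *; unfold crt_digit; numdef; [apply NumDef_detQ|apply NumDef_crt_weight]; poly.
Qed.

Lemma NumDef_rankB V (k s p r : term V) Y : RelDef2 Y ->
  PolyTerm k -> PolyTerm s -> PolyTerm p -> PolyTerm r ->
  NumDef (fun i e => rankB (N i) (k i e) (s i e) (p i e) (Y i e) (r i e)).
Proof.
move=> DY *; unfold rankB; numdef; apply NumDef_iterB; poly.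
move=> W w x a b; unfold frac_step; numdef; try (apply NumDef_inQ; poly).
exact: (DY _ (fun v => Some (Some (w (Some v))))).
Qed.

Lemma NumDef_sumB V (k s p x : term V) Y : RelDef2 Y ->
  PolyTerm k -> PolyTerm s -> PolyTerm p -> PolyTerm x ->
  NumDef (fun i e => sumB (N i) (k i e) (s i e) (p i e) (Y i e) (x i e)).
Proof.
move=> DY *; unfold sumB; numdef; apply NumDef_iterB; poly.
move=> W w y a b; unfold sum_step; numdef; try (apply NumDef_inQ; poly).
exact: (DY _ (fun v => Some (Some (Some (w (Some (Some v))))))).
Qed.

Lemma NumDef_det_modB V (k s p v : term V) :
  PolyTerm k -> PolyTerm s -> PolyTerm p -> PolyTerm v ->
  NumDef (fun i e => det_modB (N i) (k i e) (s i e) (A i) (p i e) (v i e)).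
Proof.
move=> *.
have W1 W (r : V -> W) : RelDef2 (fun i (e : W -> nat) => crt_weight (N i) (k i (fun v => e (r v))) (s i (fun v => e (r v))) (p i (fun v => e (r v)))).
  by move=> X q x y; apply NumDef_crt_weight; poly.
have W2 W (r : V -> W) : RelDef2 (fun i (e : W -> nat) => crt_digit (N i) (k i (fun v => e (r v))) (s i (fun v => e (r v))) (A i) (p i (fun v => e (r v)))).
  by move=> X q x y; apply NumDef_crt_digit; poly.
unfold det_modB; numdef; (apply NumDef_rankB || apply NumDef_sumB); poly;
  (apply (W1 _ (fun v => Some (Some (Some (Some v))))) || apply (W2 _ (fun v => Some (Some (Some (Some v)))))).
Qed.

Lemma NumDef_det_defB V (p v : V) :
  NumDef (fun i e => det_defB (N i) (A i) (e p) (e v)).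
Proof.
by unfold det_defB, sizeB, slotsB; numdef; apply NumDef_det_modB; poly.
Qed.
Transparent num_definable poly_term.
End Definable.

(** * Correctness of the formula *)

(** Chinese remaindering by induction on the sequence. The bound by the product of the moduli is
    what keeps a coded vector below N. *)
Lemma crt_seq (X : eqType) (r : seq X) (f a : X -> nat) :
  uniq r -> {in r, forall x, prime (f x)} -> {in r &, injective f} ->
  exists2 t, t < \prod_(x <- r) f x & {in r, forall x, t = a x %[mod f x]}.
Proof.
elim: r => [|x r IH] /=; first by exists 0; rewrite ?big_nil.
case/andP=> xr Ur fp fI; have [||t tlt tE] := IH Ur.
- by move=> y yr; apply: fp; rewrite inE yr orbT.
- by move=> y z yr zr; apply: fI; rewrite inE ?yr ?zr orbT.
have fx := fp x (mem_head _ _).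
have f0 : 0 < f x by apply: prime_gt0.
set Q := \prod_(y <- r) f y in tlt.
have co : coprime (f x) Q.
  rewrite /Q big_seq; elim/big_ind: _ => [|u v cu cv|y yr]; first by rewrite coprimen1.
    by rewrite coprimeMr cu.
  have yxr : y \in x :: r by rewrite inE yr orbT.
  rewrite prime_coprime // dvdn_prime2 ?fp ?mem_head //; apply: (contraNN _ xr) => /eqP.
  by move/(fI _ _ (mem_head _ _) yxr) => ->.
exists (chinese (f x) Q (a x) t %% (f x * Q)).
  by rewrite big_cons ltn_mod muln_gt0 f0 (leq_trans _ tlt).
move=> y; rewrite inE => /orP[/eqP->|yr].
  by rewrite modn_dvdm ?dvdn_mulr // chinese_modl.
have dQ : f y %| Q by rewrite /Q (big_rem y) //= dvdn_mulr.
rewrite modn_dvdm ?dvdn_mull // -tE // -(modn_dvdm _ dQ) chinese_modr //.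
by rewrite modn_dvdm.
Qed.

Lemma ord_choice k T (P : 'I_k -> T -> Prop) :
  (forall i, exists u, P i u) -> exists f : 'I_k -> T, forall i, P i (f i).
Proof. exact: (@fin_all_exists _ (fun=> T) P). Qed.

Section Basic.
Variable N : nat.

Lemma dvdBP m x : x < N -> dvdB N m x <-> m %| x.
Proof.
move=> xN; split=> [[z [_ ->]]|/dvdnP[z ez]]; first exact: dvdn_mull.
have [m0|m0] := posnP m; last first.
  by exists z; split=> //; apply: leq_ltn_trans xN; rewrite ez leq_pmulr.
by exists 0; split; rewrite ?ez ?m0 ?muln0 //; exact: leq_ltn_trans xN.
Qed.

Lemma remBP x m r : x < N -> remB N x m r <-> 0 < m /\ r = x %% m.
Proof.
move=> xN; split=> [[rm [z [_ ->]]]|[m0 ->]].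
  by rewrite modnMDl modn_small // (leq_ltn_trans _ rm).
split; first by rewrite ltn_mod.
by exists (x %/ m); rewrite -divn_eq; split=> //; apply: leq_ltn_trans (leq_div _ _) xN.
Qed.

Lemma congB_mod x y m : congB N x y m -> x = y %[mod m].
Proof. by case=> z [_ [->|->]]; rewrite addnC modnMDl. Qed.

Lemma congBP x y m : 0 < m -> x < N -> y < N -> congB N x y m <-> x = y %[mod m].
Proof.
move=> m0 xN yN; split=> [|E]; first exact: congB_mod.
wlog le_xy : x y xN yN E / x <= y => [H|].
  have [/H|/ltnW/H] := leqP x y; first exact.
  by case=> // z [zN H']; exists z; split=> //; tauto.
have /dvdnP[z ez] : m %| y - x by rewrite -eqn_mod_dvd // E.
exists z; split; last by right; rewrite -ez subnKC.
apply: leq_ltn_trans yN; apply: leq_trans (leq_subr x y).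
by rewrite ez leq_pmulr.
Qed.

Lemma primeBP q : q < N -> primeB N q <-> prime q.
Proof.
move=> qN; split=> [[q1 H]|q_pr].
  apply/primeP; split=> // m mq.
  have mN : m < N by apply: leq_ltn_trans qN; apply: dvdn_leq mq; apply: ltnW.
  by have [|->|->] := H m mN; rewrite ?dvdBP ?eqxx ?orbT.
split; first exact: prime_gt1.
by move=> m mN; rewrite dvdBP //; case/primeP: q_pr => _ H /H/orP[]/eqP; tauto.
Qed.
End Basic.

(** * Coded vectors, chains and iterations *)

Section Coding.
Variables (N k s : nat).
Local Notation entry := (entryB N k s).
Local Notation slot := (slotB N k s).

Lemma slot_fun i q q' : q < N -> q' < N -> slot i q -> slot i q' -> q = q'.
Proof.
move=> qN qN' [T1 [P1 [R1 H1]]] [T2 [P2 [R2 H2]]].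
case: (ltngtP q q') => // lt; first by case: (H2 q qN).
by case: (H1 q' qN').
Qed.

Lemma rem_fun x m r r' : x < N -> remB N x m r -> remB N x m r' -> r = r'.
Proof. by move=> xN; rewrite !remBP // => -[_ ->] [_ ->]. Qed.

Lemma entry_fun t i x y : t < N -> entry t i x -> entry t i y -> x = y.
Proof.
move=> tN [q [qN [sq rq]]] [q' [qN' [sq' rq']]].
move: rq'; rewrite -(slot_fun qN qN' sq sq').
by apply: rem_fun rq.
Qed.

Hypothesis sN : s < N.
Hypothesis good : slotsB N k s.
Hypothesis kN : k < N.
Hypothesis roomN : k ^ (38 * k.+1) <= N.

(** Every modulus exceeds k^18, so an entry is recovered exactly as a remainder; the k + 1 moduli
    are below k^38, whence t < N. *)
Lemma encode (a : nat -> nat) : (forall i, i <= k -> a i <= k ^ 18) ->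
  exists2 t, t < N & forall i, i <= k -> entry t i (a i).
Proof.
move=> aT.
have [f Hf] : exists f : 'I_k.+1 -> nat,
    forall i : 'I_k.+1, f i < N /\ f i < k ^ 38 /\ slot i (f i).
  apply: (ord_choice (P := fun i q => q < N /\ q < k ^ 38 /\ slot i q)) => i; have iN : i < N by apply: leq_trans kN; apply: ltn_ord.
  by have [|q Hq] := good iN; [rewrite -ltnS|exists q].
have [|||t tlt tE] := @crt_seq _ (enum 'I_k.+1) f (fun i => a i).
- exact: enum_uniq.
- by move=> i _; have [fN [_ [_ [/primeBP h _]]]] := Hf i; apply: h.
- move=> i j _ _ e; have [fN [_ [_ [_ [ri _]]]]] := Hf i.
  have [_ [_ [_ [_ [rj _]]]]] := Hf j.
  by apply: val_inj; rewrite -e in rj; exact: rem_fun ri rj.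
have tN : t < N.
  apply: leq_trans tlt _; apply: leq_trans roomN; rewrite expnM.
  apply: (@leq_trans (\prod_(i <- enum 'I_k.+1) k ^ 38)).
    by apply: leq_prod => i _; have [_ [/ltnW]] := Hf i.
  by rewrite big_const_seq count_predT iter_muln_1 size_enum_ord.
exists t => // i ik; pose j : 'I_k.+1 := inord i.
have ij : i = j :> nat by rewrite inordK.
have [fN [_ sl]] := Hf j; exists (f j); split=> //; split; first by rewrite ij.
have Tq : k ^ 18 < f j by case: sl.
apply/remBP => //; split; first exact: leq_ltn_trans Tq.
rewrite tE ?mem_enum // -ij modn_small //.
by apply: leq_ltn_trans Tq; apply: aT.
Qed.

(** By [entry_fun] the code has only one entry at each index, so the states mentioned by consecutive
    steps agree. *)
Lemma chain_sound G x a b : chainB N k s G x a b ->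
  exists st : nat -> nat, [/\ st 0 = a, st k = b &
    forall i, i < k -> st i.+1 < N /\ G (x * k + i) (st i) (st i.+1)].
Proof.
case=> t [tN [e0 [ek H]]].
have [f Hf] : exists f : 'I_k.+1 -> nat, forall i : 'I_k.+1, entry t i (f i).
  apply: (ord_choice (P := fun i x => entry t i x)) => -[i /= ik]; move: ik; rewrite ltnS leq_eqVlt.
  case/orP=> [/eqP->|ik]; first by exists b.
  have [_ [_ [c [_ [_ [_ [_ [e _]]]]]]]] := H i (ltn_trans ik kN) ik.
  by exists c.
have Ef i : i <= k -> entry t i (f (inord i)).
  by move=> ik; have := Hf (inord i); rewrite inordK.
exists (fun i => f (inord i)); split.
- exact: entry_fun tN (Ef 0 (leq0n k)) e0.
- exact: entry_fun tN (Ef k (leqnn k)) ek.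
move=> i ik; have [y [_ [c [_ [c' [cN' [-> [e1 [e2 g]]]]]]]]] := H i (ltn_trans ik kN) ik.
by rewrite (entry_fun tN (Ef _ (ltnW ik)) e1) (entry_fun tN (Ef _ ik) e2).
Qed.

Lemma chain_complete (G : nat -> nat -> nat -> Prop) x (st : nat -> nat) :
  k ^ 18 < N -> x * k + k <= N ->
  (forall i, i <= k -> st i <= k ^ 18) ->
  (forall i, i < k -> G (x * k + i) (st i) (st i.+1)) ->
  chainB N k s G x (st 0) (st k).
Proof.
move=> TN xN stT HG; have [t tN Ht] := encode stT.
exists t; split=> //; split; [exact: Ht|split; first exact: Ht].
move=> i iN ik; exists (x * k + i); split; first by lia.
exists (st i); split; first by apply: leq_ltn_trans TN; apply/stT/ltnW.
exists (st i.+1); split; first by apply: leq_ltn_trans TN; apply: stT.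
by split=> //; split; [apply/Ht/ltnW|split; [apply: Ht|apply: HG]].
Qed.

Lemma chainP (G : nat -> nat -> nat -> Prop) x (st : nat -> nat) b :
  k ^ 18 < N -> x * k + k <= N ->
  (forall i, i <= k -> st i <= k ^ 18) ->
  (forall i c, i < k -> c < N -> G (x * k + i) (st i) c <-> c = st i.+1) ->
  chainB N k s G x (st 0) b <-> b = st k.
Proof.
move=> TN xN stT HG; split=> [/chain_sound[f [f0 <- Hf]]|->]; last first.
  apply: chain_complete => // i ik; apply/HG => //.
  by apply: leq_ltn_trans TN; apply: stT.
suff H i : i <= k -> f i = st i by apply: H.
elim: i => // i IH ik; have [fN] := Hf i ik.
by rewrite IH ?HG // ltnW.
Qed.

(** A chain at level n + 1 samples the trajectory [st] every k^n steps, and the induction hypothesis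
    covers the stretches in between. As the step relation is deterministic along [st], no other run
    can be guessed. *)
Lemma iterP n (G : nat -> nat -> nat -> Prop) (st : nat -> nat) K x b :
  k ^ 18 < N -> K <= N -> 0 < k ->
  (forall i, i <= K -> st i <= k ^ 18) ->
  (forall i c, i < K -> c < N -> G i (st i) c <-> c = st i.+1) ->
  x.+1 * k ^ n <= K -> b < N ->
  iterB N k s n G x (st (x * k ^ n)) b <-> b = st (x.+1 * k ^ n).
Proof.
move=> TN KN k0 stT HG; elim: n x b => [|n IH] x b xK bN /=.
  by rewrite !muln1 HG // -(muln1 x.+1).
have kn : 0 < k ^ n by rewrite expn_gt0 k0.
rewrite expnS in xK *.
have -> : x * (k * k ^ n) = (x * k + 0) * k ^ n by rewrite addn0 mulnA.
have -> : x.+1 * (k * k ^ n) = (x * k + k) * k ^ n.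
  by rewrite mulnA mulSn addnC.
have xkN : (x * k + k) * k ^ n <= K by rewrite [_ + k]addnC -mulSn -mulnA.
apply: (@chainP _ x (fun i => st ((x * k + i) * k ^ n))) => //.
- by apply: leq_trans KN; apply: leq_trans xkN; rewrite leq_pmulr.
- by move=> i ik; apply: stT; apply: leq_trans xkN; rewrite leq_mul2r leq_add2l ik orbT.
move=> i c ik cN; rewrite addnS; apply: IH => //.
by apply: leq_trans xkN; rewrite leq_mul2r -addnS leq_add2l ik orbT.
Qed.
End Coding.

(** [encode] takes a vector indexed by numbers up to k, so functions on 'I_k are continued by 0. *)
Definition ext k (f : 'I_k -> nat) (i : nat) : nat :=
  if insub i is Some j then f j else 0.

Lemma ext_ord k (f : 'I_k -> nat) (i : 'I_k) : ext f i = f i.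
Proof. by rewrite /ext valK. Qed.

Lemma ext_le k (f : 'I_k -> nat) b i : (forall j, f j <= b) -> ext f i <= b.
Proof. by rewrite /ext; case: insub. Qed.

(** * The determinant modulo a small prime *)

Section DetModQ.
Variables (N k s : nat) (A : nat -> nat -> nat -> Prop) (a : nat -> nat -> nat).
Hypothesis HA : forall i j z, A i j z <-> [/\ i < k, j < k & z = a i j].
Hypothesis aN : forall i j, i < k -> j < k -> a i j < N.
Hypothesis k2 : 1 < k.
Hypothesis sN : s < N.
Hypothesis good : slotsB N k s.
Hypothesis roomN : k ^ (38 * k.+1) <= N.

Lemma expn38_room : k ^ 38 <= N.
Proof. by apply: leq_trans roomN; rewrite leq_exp2l // leq_pmulr. Qed.

Lemma expn_room c : c < 38 -> k ^ c < N.
Proof. by move=> h; apply: leq_trans expn38_room; rewrite ltn_exp2l. Qed.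

Lemma k_room : k < N. Proof. exact: (@expn_room 1). Qed.
Lemma T_room : k ^ 18 < N. Proof. exact: expn_room. Qed.

Variable q : nat.
Hypothesis q_pr : prime q.
Hypothesis q_lt : q < k ^ 8.

Lemma q_room : q < N. Proof. by apply: ltn_trans q_lt _; apply: expn_room. Qed.

Lemma matQP i j x :
  matQ N A q i j x <-> [/\ i < k, j < k & x = a i j %% q].
Proof.
split=> [[z [zN [/HA[ik jk ->] /remBP[]]]]|[ik jk ->]]; first exact: aN.
  by [].
exists (a i j); split; first exact: aN.
by split; [apply/HA|apply/remBP; [exact: aN|rewrite prime_gt0]].
Qed.

Definition wval (h : nat -> nat) i j : nat :=
  a i j %% q + (if h i < k then a (h i) j %% q else 0).

Lemma wval_lt h i j : wval h i j < 2 * q.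
Proof.
have m x : x %% q < q by rewrite ltn_mod prime_gt0.
by rewrite /wval; case: ifP => _; rewrite mul2n -addnn; have := m (a i j); have := m (a (h i) j); lia.
Qed.

(** [luQ] does not state separately that the entries of [l] are admissible; any value of [wQ] in row
    i shows it for entry i. *)
Lemma wQ_row l i j x : l < N -> wQ N k s A q l i j x ->
  exists h, entryB N k s l i h /\ i < h <= k.
Proof.
move=> lN [h [hN [e H]]]; exists h; split=> //.
case: H => [[-> /matQP[ik _ _]]|[[ih hk] _]]; first by rewrite ik leqnn.
by rewrite ih ltnW.
Qed.

Lemma wQP h l i j x : l < N -> entryB N k s l i (h i) -> i < h i <= k ->
  i < k -> j < k -> wQ N k s A q l i j x <-> x = wval h i j.
Proof.
move=> lN ent /andP[ih hk] ik jk; rewrite /wval; split.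
  case=> h' [_ [e']]; rewrite -(entry_fun lN ent e').
  case=> [[-> /matQP[_ _ ->]]|[[_ hk'] [u [_ [v [_ [/matQP[_ _ ->] [/matQP[_ _ ->] ->]]]]]]]].
    by rewrite ltnn addn0.
  by rewrite hk'.
have m z : z %% q < N by apply: ltn_trans q_room; rewrite ltn_mod prime_gt0.
move=> ->; exists (h i); split; first by apply: leq_ltn_trans k_room.
split=> //; move: hk; rewrite leq_eqVlt => /orP[/eqP->|hk].
  by left; split=> //; rewrite ltnn addn0; apply/matQP.
right; split=> //; exists (a i j %% q); split=> //; exists (a (h i) j %% q).
by split=> //; do 2!(split; first by apply/matQP); rewrite hk.
Qed.

Let B : 'M['F_q]_k := (\matrix_(i, j) (a i j)%:R)%R.

Lemma wval_mx (h : nat -> nat) (i j : 'I_k) : i < h i <= k ->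
  ((wval h i j)%:R = (addrow 'F_q (fun i : 'I_k => h i) *m B) i j)%R.
Proof.
move=> /andP[_ hk]; rewrite addrowE natrD !mxE Fp_nat_mod //; congr (_ + _)%R.
case: ifP => hk'; last first.
  by rewrite big1 // => m /eqP mh; have := ltn_ord m; rewrite mh hk'.
by rewrite (big_pred1 (Ordinal hk')) // mxE Fp_nat_mod.
Qed.

Lemma dotQ_sound l h y (L : nat -> nat) j x : l < N -> y < N -> j < k ->
  (forall i, i < k -> entryB N k s l i (h i) /\ i < h i <= k) ->
  (forall i, i < k -> entryB N k s y i (L i)) ->
  dotQ N k s A q l y j x -> x = \sum_(m < k) L m * wval h m j.
Proof.
move=> lN yN jk Hh HL /(chain_sound k_room)[st [st0 <- Hst]].
suff H m : m <= k -> st m = \sum_(i < m) L i * wval h i j by apply: H.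
elim: m => [|m IH] mk; first by rewrite big_ord0.
have [_ [u [_ [w [_ []]]]]] := Hst m mk.
rewrite mul0n add0n => eu [ew ->]; rewrite big_ord_recr /= IH ?(ltnW mk) //.
rewrite (entry_fun yN (HL m mk) eu).
have [eh hh] := Hh m mk.
by move/(wQP _ lN eh hh mk jk): ew => ->.
Qed.

Lemma dotQ_complete l h y (L : nat -> nat) j : l < N -> y < N -> j < k ->
  (forall i, i < k -> entryB N k s l i (h i) /\ i < h i <= k) ->
  (forall i, i < k -> entryB N k s y i (L i)) ->
  (forall i, i < k -> L i < q) ->
  dotQ N k s A q l y j (\sum_(m < k) L m * wval h m j).
Proof.
move=> lN yN jk Hh HL Lq.
have bd m : m <= k -> \sum_(i < m) L i * wval h i j <= k ^ 18.
  move=> mk; apply: (@leq_trans (\sum_(i < m) (q * (2 * q)))).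
    apply: leq_sum => i _; apply: leq_mul; last exact/ltnW/wval_lt.
    by apply/ltnW/Lq; apply: leq_trans mk.
  rewrite sum_nat_const card_ord (_ : 18 = 1 + (8 + (1 + 8))) // !expnD !expn1.
  by apply: leq_mul => //; apply: leq_mul; [exact: ltnW|apply: leq_mul => //; exact: ltnW].
have := @chain_complete N k s sN good k_room roomN (dot_stepQ N k s A q l y j) 0
   (fun m => \sum_(i < m) L i * wval h i j) T_room.
rewrite /= big_ord0; apply=> //; first by rewrite mul0n; apply/ltnW/k_room.
move=> i ik; have Lik := Lq i ik; exists (L i); split; first exact: ltn_trans q_room.
exists (wval h i j); split.
  apply: leq_trans (wval_lt _ _ _) _; apply: (@leq_trans (k * k ^ 8)).
    by apply: leq_mul => //; exact: ltnW.
  by rewrite -expnS; exact/ltnW/expn_room.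
have [eh hh] := Hh i ik.
rewrite mul0n add0n; split; first exact: HL.
by split; [apply/(wQP _ lN eh hh ik jk)|rewrite big_ord_recr].
Qed.

Lemma luQ_sound x : luQ N k s A q x -> x < q /\ (x%:R = \det B)%R.
Proof.
case=> l [lN [c [cN [rows prod]]]].
have [u Hu] : exists u : 'I_k -> nat, forall i : 'I_k,
    entryB N k s c i (u i) /\ exists y, y < N /\ rowQ N k s A q l i y (u i).
  apply: (ord_choice (P := fun i v => entryB N k s c i v /\
     exists y, y < N /\ rowQ N k s A q l i y v)) => i.
  have [v [_ [y [yN [e r]]]]] := rows i (ltn_trans (ltn_ord i) k_room) (ltn_ord i).
  by exists v; split=> //; exists y.
have [y Hy] : exists y : 'I_k -> nat, forall i : 'I_k,
    y i < N /\ rowQ N k s A q l i (y i) (u i).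
  apply: (ord_choice (P := fun i v => v < N /\ rowQ N k s A q l i v (u i))) => i.
  by have [] := Hu i.
(* The dot product for pivot i visits every m, so it provides entry m of [y i] as well as an entry
   of row m of W A. *)
have step (i m : 'I_k) : exists v w, entryB N k s (y i) m v /\ wQ N k s A q l m i w.
  have [_ [_ [_ [z [_ [dt _]]]]]] := Hy i.
  have [st [_ _ H]] := chain_sound k_room dt.
  have [_ [v [_ [w [_ [e1 [e2 _]]]]]]] := H m (ltn_ord m).
  by exists v, w.
have [h Hh] : exists h : 'I_k -> nat, forall i : 'I_k,
    entryB N k s l i (h i) /\ i < h i <= k.
  apply: (ord_choice (P := fun (i : 'I_k) v => entryB N k s l i v /\ i < v <= k)) => i.
  by have [v [w [_ /(wQ_row lN)]]] := step i i.
have [L0 HL0] : exists L0 : 'I_k -> 'I_k -> nat, forall i m : 'I_k,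
    entryB N k s (y i) m (L0 i m).
  apply: (ord_choice (P := fun (i : 'I_k) f =>
     forall m : 'I_k, entryB N k s (y i) m (f m))) => i.
  apply: (ord_choice (P := fun (m : 'I_k) v => entryB N k s (y i) m v)) => m.
  by have [v [w [e _]]] := step i m; exists v.
pose L : 'M['F_q]_k := (\matrix_(i, m) (L0 i m)%:R)%R.
have Hh' i : i < k -> entryB N k s l i (ext h i) /\ i < ext h i <= k.
  by move=> ik; have := Hh (Ordinal ik); rewrite -(ext_ord h).
have HL0' (i : 'I_k) m : m < k -> entryB N k s (y i) m (ext (L0 i) m).
  by move=> mk; have := HL0 i (Ordinal mk); rewrite -(ext_ord (L0 i)).
have hE (i : 'I_k) : ext h i = h i by exact: ext_ord.
have addE : addrow 'F_q h = addrow 'F_q (fun i : 'I_k => ext h i).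
  by apply/matrixP => i j; rewrite !mxE hE.
have dotE (i j : 'I_k) z : dotQ N k s A q l (y i) j z ->
    (z%:R = (L *m (addrow 'F_q h *m B)) i j)%R.
  have [yN _] := Hy i.
  move/(dotQ_sound lN yN (ltn_ord j) Hh' (@HL0' i)) => ->.
  rewrite natr_sum [RHS]mxE; apply: eq_bigr => m _.
  by rewrite natrM ext_ord addE -wval_mx ?mxE // hE; have [] := Hh m.
have ltN (i : 'I_k) : i < N by apply: ltn_trans k_room.
have L1 i : (L i i = 1)%R.
  have [yN [r1 _]] := Hy i; rewrite mxE.
  have [/(_ erefl) e _] := r1 i (ltN i) (ltn_ord i).
  by rewrite (entry_fun yN (HL0 i i) e).
have L00 (i j : 'I_k) : i < j -> (L i j = 0)%R.
  move=> ij; have [yN [r1 _]] := Hy i; rewrite mxE.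
  have [_ /(_ ij) e] := r1 j (ltN j) (ltn_ord j).
  by rewrite (entry_fun yN (HL0 i j) e).
have U0 (i j : 'I_k) : j < i -> ((L *m (addrow 'F_q h *m B)) i j = 0)%R.
  move=> ji; have [yN [_ [r2 _]]] := Hy i.
  have [z [zN [/dotE<- dv]]] := r2 j (ltN j) ji.
  by apply/eqP; rewrite -(dvdn_pcharf (pchar_Fp q_pr)); apply/(dvdBP _ zN).
have UE (i : 'I_k) : ((L *m (addrow 'F_q h *m B)) i i = (u i)%:R)%R.
  have [yN [_ [_ [z [zN [/dotE<- /congB_mod]]]]]] := Hy i.
  by move/eq_modFp => ->.
rewrite (lu_sound (fun i => proj1 (andP (proj2 (Hh i)))) L1 L00 U0).
have [st [st0 stk Hst]] := chain_sound k_room prod.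
have H m : m <= k -> ((st m)%:R = \prod_(i < m) (ext u i)%:R :> 'F_q)%R /\
    (0 < m -> st m < q).
  elim: m => [|m IH] mk; first by rewrite big_ord0 st0.
  have [_ [v [_ [ev [lt [z [_ e]]]]]]] := Hst m mk; split=> //.
  have [eu _] := Hu (Ordinal mk); rewrite mul0n add0n in ev.
  have {}IH := (IH (ltnW mk)).1.
  rewrite big_ord_recr /= -IH -natrM (_ : ext u m = v); last first.
    by rewrite -[m]/(nat_of_ord (Ordinal mk)) ext_ord; exact: entry_fun cN eu ev.
  by apply/eq_modFp => //; rewrite e modnMDl.
have [H1 H2] := H k (leqnn k).
rewrite -stk; split; first by apply: H2; apply: ltnW.
by rewrite H1; apply: eq_bigr => i _; rewrite UE ext_ord.
Qed.

Lemma luQ_complete : (\det B != 0)%R -> exists2 x, x < N & luQ N k s A q x.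
Proof.
move/lu_complete=> [h [L [hP L1 L00 U0]]].
have vq (x : 'F_q) : (x : nat) < q by exact: Fp_lt.
have qT : q <= k ^ 18.
  by apply: leq_trans (ltnW q_lt) _; rewrite leq_exp2l.
pose U := (L *m (addrow 'F_q h *m B))%R.
have enc := encode sN good k_room roomN.
have natF (x : 'F_q) : ((x : nat)%:R = x)%R by exact: natr_Zp.
have [l lN Hl] : exists2 l, l < N & forall i : 'I_k, entryB N k s l i (h i).
  have [|l lN Hl] := enc (ext h).
    move=> i _; apply: ext_le => j; have /andP[_ hk] := hP j.
    by apply: leq_trans hk _; rewrite -{1}(expn1 k) leq_exp2l.
  by exists l => // i; rewrite -(ext_ord h); apply/Hl/ltnW.
have [c cN Hc] : exists2 c, c < N & forall i : 'I_k, entryB N k s c i (U i i).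
  have [|c cN Hc] := enc (ext (fun i => U i i : nat)).
    by move=> i _; apply: ext_le => j; apply: leq_trans (ltnW (vq _)) qT.
  by exists c => // i; have := Hc i (ltnW (ltn_ord i)); rewrite ext_ord.
have hP' (i : nat) : i < k -> entryB N k s l i (ext h i) /\ i < ext h i <= k.
  by move=> ik; have := Hl (Ordinal ik); have := hP (Ordinal ik); rewrite -(ext_ord h).
have addE : addrow 'F_q h = addrow 'F_q (fun i : 'I_k => ext h i).
  by apply/matrixP => i j; rewrite !mxE ext_ord.
pose st m := (\prod_(i < m) ext (fun i => U i i : nat) i) %% q.
have [q0 q1] : 0 < q /\ 1 < q by rewrite prime_gt0 ?prime_gt1.
have stq m : st m < q by rewrite ltn_mod.
exists (st k); first exact: ltn_trans q_room.
exists l; split=> //; exists c; split=> //; split; last first.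
  have := @chain_complete N k s sN good k_room roomN (fun i a0 b =>
     exB N (fun u => entryB N k s c i u /\ remB N (a0 * u) q b)) 0 st T_room.
  have -> : st 0 = 1 by rewrite /st big_ord0 modn_small.
  apply.
  - by rewrite mul0n; apply/ltnW/k_room.
  - by move=> i _; apply: leq_trans (ltnW (stq i)) qT.
  move=> i ik; rewrite mul0n add0n; pose o := Ordinal ik.
  exists (U o o); split; first exact: ltn_trans (vq _) q_room.
  split; first exact: (Hc o).
  apply/remBP.
    apply: (@leq_trans (k ^ 8 * k ^ 8)); last by rewrite -expnD; apply/ltnW/expn_room.
    apply: (@leq_trans (q * q)); first by apply: ltn_mul => //; exact: vq.
    by apply: leq_mul; exact: ltnW.
  split=> //; rewrite /st big_ord_recr /= -[i]/(nat_of_ord o) ext_ord.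
  by rewrite modnMml.
move=> i iN ik; pose o := Ordinal ik.
exists (U o o); split; first exact: ltn_trans (vq _) q_room.
have [|y yN Hy] := enc (ext (fun m => L o m : nat)).
  by move=> m _; apply: ext_le => j; apply: leq_trans (ltnW (vq _)) qT.
have dot (j : 'I_k) : exists z, z < N /\ dotQ N k s A q l y j z /\ (z%:R = U o j)%R.
  have := dotQ_complete lN yN (ltn_ord j) hP' (fun m mk => Hy m (ltnW mk)).
  set z := \sum_(m < k) _ => dz; exists z.
  have {}dz : dotQ N k s A q l y j z.
    apply: dz => m mk; rewrite -[m]/(nat_of_ord (Ordinal mk)) ext_ord; exact: vq.
  split.
    have bd : z <= k * (q * (2 * q)).
      rewrite -[k in k * _]card_ord -sum_nat_const; apply: leq_sum => m _.
      by rewrite ext_ord; apply: leq_mul; [exact/ltnW/vq|exact/ltnW/wval_lt].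
    apply: leq_ltn_trans bd _; apply: (@leq_ltn_trans (k ^ 18)); last exact: T_room.
    rewrite (_ : 18 = 1 + (8 + (1 + 8))) // !expnD !expn1.
    by apply: leq_mul => //; apply: leq_mul; [exact: ltnW|apply: leq_mul => //; exact: ltnW].
  split=> //; rewrite natr_sum [RHS]mxE; apply: eq_bigr => m _.
  by rewrite natrM ext_ord natF addE -wval_mx // ext_ord.
exists y; split=> //; split; first exact: (Hc o).
split; [|split].
- move=> m mN mk; pose m' := Ordinal mk; have := Hy m (ltnW mk).
  rewrite -[m in ext _ m]/(nat_of_ord m') ext_ord => e.
  split=> [mi|im].
    move: e; rewrite (_ : m' = o) ?L1; last exact: val_inj.
    by have := val_Fp_nat q_pr 1; rewrite (modn_small q1) => ->.
  by move: e; rewrite L00.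
- move=> j jN ji; have jk := ltn_trans ji ik; have [z [zN [dz ez]]] := dot (Ordinal jk).
  exists z; split=> //; split=> //; apply/(dvdBP _ zN).
  by rewrite (dvdn_pcharf (pchar_Fp q_pr)) ez /U U0.
have [z [zN [dz ez]]] := dot o; exists z; split=> //; split=> //.
apply/congBP => //; first exact: ltn_trans (vq _) q_room.
by apply/eq_modFp => //; rewrite ez natF.
Qed.

Lemma detQP x : x < N -> detQ N k s A q x <-> x = (\det B)%R.
Proof.
have S y : luQ N k s A q y -> y = (\det B)%R.
  case/luQ_sound=> yq e; have := congr1 val e.
  by rewrite /= val_Fp_nat // modn_small.
move=> xN; split=> [[/S//|[-> nex]]|->].
  have [->//|/luQ_complete[y yN Hy]] := eqVneq (\det B)%R 0%R.
  by case: nex; exists y.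
have [[y [yN Hy]]|nex] := EM (exB N (luQ N k s A q)).
  by left; rewrite -(S _ Hy).
right; split=> //; have [->//|/luQ_complete[y yN Hy]] := eqVneq (\det B)%R 0%R.
by case: nex; exists y.
Qed.
End DetModQ.

(** The rank is quantified below N and therefore needs a bound; R itself is one. *)
Lemma round_le K r R : 0 < K -> 2 * r * K < 2 * R + K -> r <= R.
Proof.
move=> K0 h; rewrite leqNgt; apply/negP => lt.
have h1 : R.+1 * K <= r * K by rewrite leq_mul2r lt orbT.
have h2 : R <= R * K by rewrite leq_pmulr.
move: h h1; rewrite [R.+1 * K]mulSn -mulnA; lia.
Qed.

(** * Reconstruction modulo p *)

Section DetModP.
Variables (N k s p : nat) (A : nat -> nat -> nat -> Prop) (a : nat -> nat -> nat).
Hypothesis HA : forall i j z, A i j z <-> [/\ i < k, j < k & z = a i j].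
Hypothesis p_pr : prime p.
Hypothesis a_lt : forall i j, a i j < p.
Hypothesis k3 : 2 < k.
Hypothesis sN : s < N.
Hypothesis good : slotsB N k s.
Hypothesis roomN : k ^ (38 * k.+1) <= N.
Hypothesis pN : p * p * k ^ 20 <= N.
Hypothesis N_lt : exists2 j, j.*2 < k ^ 8 & N <= 2 ^ j.

Let Q := [seq q <- iota 0 (k ^ 8) | prime q && (q != p)].
Hypothesis Q_large : 4 * (k ^ k * p ^ k) < \prod_(q <- Q) q.

Let k2 : 1 < k. Proof. exact: ltnW. Qed.
Let k0 : 0 < k. Proof. exact: ltnW. Qed.
Let p0 : 0 < p. Proof. exact: prime_gt0. Qed.
Let room := expn_room k2 roomN.
Let kltN := k_room k2 roomN.
Let TltN := T_room k2 roomN.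

Lemma p_ltN : p < N.
Proof.
apply: leq_trans pN; rewrite -mulnA -[X in X < _]muln1 ltn_pmul2l //.
by apply: leq_trans (prime_gt1 p_pr) (leq_pmulr _ _); rewrite expn_gt0 k0.
Qed.

Lemma crt_primes_uniq : uniq Q.
Proof. by rewrite /Q; apply: filter_uniq; apply: iota_uniq. Qed.

Lemma mem_crt_primes q : (q \in Q) = [&& prime q, q != p & q < k ^ 8].
Proof. by rewrite /Q mem_filter mem_iota add0n leq0n -andbA. Qed.

Lemma crt_primes_prime : all prime Q.
Proof. by apply/allP => q; rewrite mem_crt_primes => /andP[]. Qed.

Lemma Q_size : size Q <= k ^ 8.
Proof. by rewrite /Q size_filter -[X in _ <= X](size_iota 0) count_size. Qed.

Lemma p_notin_crt_primes : p \notin Q. Proof. by rewrite mem_crt_primes eqxx andbF. Qed.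

Lemma inQ_primeP x : x < N -> inQ N p x <-> prime x && (x != p).
Proof.
move=> xN; rewrite /inQ primeBP //.
by split=> [[-> /eqP]|/andP[-> /eqP]].
Qed.

Lemma Q8N x : x < k ^ 8 -> x < N.
Proof. by move=> h; apply: ltn_trans h _; apply: room. Qed.

Lemma iter8P (G : nat -> nat -> nat -> Prop) (st : nat -> nat) b :
  (forall i, i <= k ^ 8 -> st i <= k ^ 18) ->
  (forall i c, i < k ^ 8 -> c < N -> G i (st i) c <-> c = st i.+1) -> b < N ->
  iterB N k s 8 G 0 (st 0) b <-> b = st (k ^ 8).
Proof.
move=> stT HG bN.
have := @iterP N k s sN good kltN roomN 8 G st (k ^ 8) 0 b TltN (ltnW (room _)) k0 stT HG.
by rewrite mul0n mul1n; apply.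
Qed.

Section Cofactor.
Variable q : nat.
Hypothesis qQ : q \in Q.

Let q_pr : prime q. Proof. by move: qQ; rewrite mem_crt_primes => /andP[]. Qed.
Let q_lt : q < k ^ 8. Proof. by move: qQ; rewrite mem_crt_primes => /and3P[]. Qed.
Let q0 : 0 < q. Proof. exact: prime_gt0. Qed.

Lemma cofP c : c < N -> iterB N k s 8 (cof_step N p q) 0 1 c <-> c = coprod Q q %% q.
Proof.
move=> cN.
(* The iteration runs over all x < k^8; those outside the product contribute the factor 1. *)
pose F x := if [&& prime x, x != p & x != q] then x else 1.
pose st y := (\prod_(0 <= x < y) F x) %% q.
have st0 : st 0 = 1 by rewrite /st big_geq // modn_small // prime_gt1.
have -> : coprod Q q = \prod_(0 <= x < k ^ 8) F x.
  rewrite /coprod /Q big_filter_cond -[iota 0 _]/(iota 0 (k ^ 8)) /F -big_mkcond /=.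
  rewrite /index_iota subn0; apply: eq_bigl => x; by rewrite andbA.
have stq y : st y < q by rewrite ltn_mod.
have := @iter8P (cof_step N p q) st c; rewrite st0; apply=> // [i _|i d iK dN].
  apply: leq_trans (ltnW (stq i)) _; apply: leq_trans (ltnW q_lt) _.
  by rewrite leq_exp2l.
have stS : st i.+1 = (st i * F i) %% q.
  by rewrite /st big_nat_recr //= modnMml.
have inE : (inQ N p i /\ i <> q) <-> [&& prime i, i != p & i != q].
  rewrite inQ_primeP; last exact: Q8N.
  by rewrite andbA; split=> [[-> /eqP]|/andP[-> /eqP]].
have mN : st i * i < N.
  apply: (@leq_ltn_trans (k ^ 8 * k ^ 8)); first by apply: leq_mul; apply: ltnW => //; exact: ltn_trans q_lt.
  by rewrite -expnD; apply: room.
rewrite /cof_step inE stS /F; case: ifP => Hi; rewrite remBP //.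
  by split=> [[[_ [_ ->]]|[]]|->] //; left.
by rewrite muln1 (modn_small (stq i)); split=> [[[]|[]]|] //; right.
Qed.

Definition weight : nat := ((coprod Q q)%:R^-1 : 'F_q)%R.

Lemma weight_lt : weight < q.
Proof. exact: Fp_lt. Qed.

Lemma coprod_neq0 : ((coprod Q q)%:R != 0 :> 'F_q)%R.
Proof.
rewrite -(dvdn_pcharf (pchar_Fp q_pr)) /coprod big_seq_cond.
elim/big_ind: _ => [|x y cx cy|x /andP[xQ xq]].
- by rewrite gtnNdvd // prime_gt1.
- by rewrite Euclid_dvdM // negb_or cx.
by rewrite dvdn_prime2 ?(allP crt_primes_prime) // eq_sym.
Qed.

Lemma weightP h : h < N -> crt_weight N k s p q h <-> h = weight.
Proof.
move=> hN.
have cN : coprod Q q %% q < N by apply: Q8N; apply: ltn_trans q_lt; rewrite ltn_mod.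
have wE : (weight%:R = (coprod Q q)%:R^-1 :> 'F_q)%R by exact: natr_Zp.
split=> [[hq [c [cN' [/(cofP cN') -> /congB_mod]]]]|->].
  rewrite modnMmr => /(eq_modFp _ _ q_pr); rewrite natrM => e.
  have : (h%:R = weight%:R :> 'F_q)%R.
    by apply: (mulIf coprod_neq0); rewrite e wE mulVf // coprod_neq0.
  by move/(eq_modFp _ _ q_pr); rewrite !modn_small // weight_lt.
split; first exact: weight_lt.
exists (coprod Q q %% q); split=> //; split; first by apply/cofP.
apply/congBP => //.
- apply: (@leq_ltn_trans (k ^ 8 * k ^ 8)).
    apply: leq_mul; apply: ltnW; first exact: ltn_trans weight_lt _.
    by apply: ltn_trans q_lt; rewrite ltn_mod.
  by rewrite -expnD; apply: room.
- by apply: ltn_trans kltN.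
rewrite modnMmr; apply/(eq_modFp _ _ q_pr); rewrite natrM wE.
by rewrite mulVf // coprod_neq0.
Qed.

Let detq : 'F_q := (\det (\matrix_(i < k, j < k) (a i j)%:R))%R.

Definition digit : nat := ((detq : nat) * weight) %% q.

Lemma digit_lt : digit < q. Proof. by rewrite ltn_mod. Qed.

Lemma digitP y : y < N -> crt_digit N k s A p q y <-> y = digit.
Proof.
move=> yN.
have dq : (detq : nat) < q by exact: Fp_lt.
have dN : (detq : nat) < N by apply: Q8N; apply: ltn_trans dq _.
have wN : weight < N by apply: Q8N; apply: ltn_trans weight_lt _.
have aN i j : i < k -> j < k -> a i j < N.
  by move=> _ _; apply: ltn_trans p_ltN.
have mN : (detq : nat) * weight < N.
  apply: (@leq_ltn_trans (k ^ 8 * k ^ 8)).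
    by apply: leq_mul; apply: ltnW; [exact: ltn_trans dq _|exact: ltn_trans weight_lt _].
  by rewrite -expnD; apply: room.
have DP := detQP HA aN k2 sN good roomN q_pr q_lt.
split=> [[x [xN [h [hN [/(DP _ xN) -> [/(weightP hN) ->]]]]]]|->].
  by case/remBP.
exists (detq : nat); split=> //; exists weight; split=> //.
by split; [apply/DP|split; [apply/weightP|apply/remBP]].
Qed.
End Cofactor.

Definition pinv q : nat := (q%:R^-1 : 'F_p)%R.

Lemma pinv_lt q : pinv q < p.
Proof. exact: Fp_lt. Qed.

Lemma pinvM q : q \in Q -> pinv q * q = 1 %[mod p].
Proof.
move=> qQ; apply/eq_modFp => //; rewrite natrM.
have -> : ((pinv q)%:R = q%:R^-1 :> 'F_p)%R by exact: natr_Zp.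
rewrite mulVf // -(dvdn_pcharf (pchar_Fp p_pr)).
by move: qQ; rewrite mem_crt_primes => /and3P[q_pr qp _]; rewrite dvdn_prime2 // eq_sym.
Qed.

Lemma pinvP q u : q \in Q -> u < p -> congB N (u * q) 1 p <-> u = pinv q.
Proof.
move=> qQ up.
have q8 : q < k ^ 8 by move: qQ; rewrite mem_crt_primes => /and3P[].
have uN : u * q < N.
  apply: leq_trans pN; rewrite -mulnA; apply: leq_trans (_ : u * q < p * q) _.
    by rewrite ltn_pmul2r // prime_gt0 // (allP crt_primes_prime).
  rewrite leq_mul2l; apply/orP; right; apply: leq_trans (ltnW q8) _.
  by apply: leq_trans (leq_pmull _ p0); rewrite leq_exp2l.
rewrite congBP //; last by apply: ltn_trans kltN.
split=> [|->]; last exact: pinvM.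
rewrite -(pinvM qQ) => /(eq_modFp _ _ p_pr); rewrite !natrM => /mulIf e.
have /e/(eq_modFp _ _ p_pr) : (q%:R != 0 :> 'F_p)%R.
  rewrite -(dvdn_pcharf (pchar_Fp p_pr)).
  by move: qQ; rewrite mem_crt_primes => /and3P[q_pr qp _]; rewrite dvdn_prime2 // eq_sym.
by rewrite !modn_small // pinv_lt.
Qed.

Section Reconstruct.
Variables (Y : nat -> nat -> Prop) (y : nat -> nat).
Hypothesis y_lt : {in Q, forall q, y q < q}.
Hypothesis HY : forall q z, q \in Q -> z < N -> Y q z <-> z = y q.

Let K := 4 * k ^ 8 + 1.
Let Rq := \sum_(q <- Q) y q * K %/ q.
Let Sq := \sum_(q <- Q) y q * pinv q.

Lemma KE : 4 * k ^ 8 + 1 = K. Proof. by []. Qed.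

(** From 4 k^8 + 1 <= 9 k^8 and k >= 3. A sum of k^8 numbers bounded by K thus stays within k^18. *)
Lemma K_le : K <= k ^ 10.
Proof.
rewrite /K (_ : 10 = 2 + 8) // expnD.
have : 9 <= k ^ 2 by rewrite (@leq_exp2r 3 k 2).
have : 0 < k ^ 8 by rewrite expn_gt0 k0.
move: (k ^ 8) (k ^ 2) => u v; nia.
Qed.

Lemma sumQ (f : nat -> nat) :
  \sum_(q <- Q) f q = \sum_(0 <= q < k ^ 8) (if prime q && (q != p) then f q else 0).
Proof. by rewrite /Q big_filter -big_mkcond /index_iota subn0. Qed.

Lemma frac_lt q : q \in Q -> y q * K %/ q < K.
Proof.
move=> qQ; rewrite ltn_divLR ?prime_gt0 ?(allP crt_primes_prime) // mulnC ltn_pmul2l ?y_lt //.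
by rewrite /K addn1.
Qed.

Lemma sum_bound (F : nat -> nat) b n : (forall x, x < n -> F x <= b) ->
  n <= k ^ 8 -> \sum_(0 <= x < n) F x <= k ^ 8 * b.
Proof.
move=> Fb nk; apply: (@leq_trans (\sum_(0 <= x < n) b)).
  rewrite big_nat [X in _ <= X]big_nat; apply: leq_sum => x /andP[_]; exact: Fb.
by rewrite sum_nat_const_nat subn0 leq_mul2r nk orbT.
Qed.

Lemma rank_iterP z : z < N -> iterB N k s 8 (frac_step N k p Y) 0 0 z <-> z = Rq.
Proof.
move=> zN; rewrite /Rq sumQ.
pose F q := if prime q && (q != p) then y q * K %/ q else 0.
pose st n := \sum_(0 <= q < n) F q.
have st0 : st 0 = 0 by rewrite /st big_geq.
have memF x : x < k ^ 8 -> prime x && (x != p) -> x \in Q.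
  by rewrite mem_crt_primes => -> /andP[-> ->].
have FK x : x < k ^ 8 -> F x <= K.
  by move=> xk; rewrite /F; case: ifP => // /(memF _ xk)/frac_lt/ltnW.
have := @iter8P (frac_step N k p Y) st z; rewrite st0; apply=> // [i ik|i c ik cN].
  apply: (@leq_trans (k ^ 8 * K)).
    by apply: sum_bound => // x xi; apply: FK; apply: leq_trans ik.
  by rewrite (_ : 18 = 8 + 10) // expnD leq_mul2l K_le orbT.
have -> : st i.+1 = st i + F i by rewrite /st big_nat_recr.
rewrite /frac_step inQ_primeP ?Q8N // KE /F; case: ifP => Hi; last first.
  by rewrite addn0; split=> [[[]|[]]|] //; right.
have iQ := memF i ik Hi.
have i0 : 0 < i by rewrite prime_gt0 // (allP crt_primes_prime).
split=> [[[_ [z1 [z1N [f [fN [/(HY iQ z1N) -> [le [lt ->]]]]]]]]|[]]|->] //.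
  congr (_ + _); apply/eqP; rewrite eqn_leq leq_divRL // le /=.
  by rewrite -ltnS ltn_divLR.
left; split=> //; exists (y i).
have yN : y i < N by apply: Q8N; apply: ltn_trans ik; apply: y_lt.
split=> //; exists (y i * K %/ i); split.
  apply: ltn_trans (frac_lt iQ) _; apply: leq_ltn_trans K_le _; exact: room.
by split; [apply/HY|rewrite leq_divM ltn_ceil].
Qed.

Lemma Rq_le : Rq <= k ^ 18.
Proof.
rewrite /Rq sumQ; apply: (@leq_trans (k ^ 8 * K)).
  apply: sum_bound => // x xk; case: ifP => // /andP[h1 h2].
  by apply/ltnW/frac_lt; rewrite mem_crt_primes h1 h2.
by rewrite (_ : 18 = 8 + 10) // expnD leq_mul2l K_le orbT.
Qed.

Lemma Rq_ltN : Rq < N.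
Proof. exact: leq_ltn_trans Rq_le TltN. Qed.

Lemma rankBP r : rankB N k s p Y r <->
  2 * r * K < 2 * Rq + K /\ 2 * Rq < 2 * r * K + K.
Proof.
rewrite /rankB KE; split=> [[z [zN [/(rank_iterP zN)->]]]|h] //.
exists Rq; split; first exact: Rq_ltN.
by split=> //; apply/rank_iterP => //; exact: Rq_ltN.
Qed.

Lemma sum_iterP m z : 0 < m -> m < k ^ 8 -> z < N ->
  iterB N k s 8 (sum_step N p Y m) 0 0 z <->
  z = \sum_(q <- Q) (y q * pinv q) %% m.
Proof.
move=> m0 mk zN; rewrite sumQ.
pose F q := if prime q && (q != p) then (y q * pinv q) %% m else 0.
pose st n := \sum_(0 <= q < n) F q.
have st0 : st 0 = 0 by rewrite /st big_geq.
have FK x : F x <= k ^ 8.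
  by rewrite /F; case: ifP => // _; apply: ltnW; apply: ltn_trans mk; rewrite ltn_mod.
have := @iter8P (sum_step N p Y m) st z; rewrite st0; apply=> // [i ik|i c ik cN].
  apply: (@leq_trans (k ^ 8 * k ^ 8)); first exact: sum_bound.
  by rewrite -expnD leq_exp2l.
have -> : st i.+1 = st i + F i by rewrite /st big_nat_recr.
rewrite /sum_step inQ_primeP ?Q8N // /F; case: ifP => Hi; last first.
  by rewrite addn0; split=> [[[]|[]]|] //; right.
have iQ : i \in Q by rewrite mem_crt_primes ik andbT.
have i0 : 0 < i by rewrite prime_gt0 // (allP crt_primes_prime).
have yN : y i < N by apply: Q8N; apply: ltn_trans ik; apply: y_lt.
have ypN : y i * pinv i < N.
  apply: leq_trans pN; rewrite -mulnA mulnC; apply: (@leq_trans (p * (p * k ^ 20))) => //.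
  apply: leq_trans (_ : pinv i * y i < p * k ^ 8) _; last first.
    rewrite leq_mul2l; apply/orP; right; apply: leq_trans (leq_pmull _ p0).
    by rewrite leq_exp2l.
  by apply: ltn_mul; [exact: pinv_lt|apply: ltn_trans ik; exact: y_lt].
split=> [[[_ [z1 [z1N [u [uN [g [gN [/(HY iQ z1N) -> [up [/(pinvP iQ up) -> [/remBP[//|_ -> ->]]]]]]]]]]]]|[]]|->] //.
left; split=> //; exists (y i); split=> //.
exists (pinv i); split; first by apply: ltn_trans (pinv_lt _) p_ltN.
exists ((y i * pinv i) %% m); split; first by apply: leq_ltn_trans (leq_mod _ _) ypN.
split; first by apply/HY.
split; first exact: pinv_lt.
split; first by apply/pinvP; rewrite ?pinv_lt.
by split=> //; apply/remBP.
Qed.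

Lemma Sq_lt : Sq <= k ^ 16 * p.
Proof.
rewrite /Sq sumQ (_ : 16 = 8 + 8) // expnD -mulnA; apply: sum_bound => // x xk.
case: ifP => // /andP[h1 h2]; apply: leq_mul; last exact/ltnW/pinv_lt.
by apply: ltnW; apply: (ltn_trans _ xk); apply: y_lt; rewrite mem_crt_primes h1 h2.
Qed.

Lemma Sq_ltN : Sq < N.
Proof.
apply: leq_ltn_trans Sq_lt _; apply: leq_trans pN.
rewrite mulnC -mulnA ltn_pmul2l //; apply: leq_trans (leq_pmull _ p0).
by rewrite ltn_exp2l.
Qed.

(** Both numbers are below N <= 2^j with 2j < k^8, so agreement modulo all positive m < k^8 makes
    them equal. *)
Lemma sumBP x : x < N -> sumB N k s p Y x <-> x = Sq.
Proof.
move=> xN.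
have E m : (\sum_(q <- Q) (y q * pinv q) %% m) = Sq %[mod m].
  by rewrite modn_summ.
have rN m : 0 < m -> m < k ^ 8 -> \sum_(q <- Q) (y q * pinv q) %% m < N.
  move=> m0 mk; rewrite sumQ; apply: (@leq_ltn_trans (k ^ 8 * k ^ 8)).
    apply: sum_bound => // q _; case: ifP => // _.
    by apply: ltnW; apply: ltn_trans mk; rewrite ltn_mod.
  by rewrite -expnD; apply: room.
split=> [H|-> m mN m0 mk].
  have [j j1 j2] := N_lt; apply: (@eq_mod_small j); try exact: leq_trans j2.
    by apply: leq_trans j2; exact: Sq_ltN.
  move=> m /andP[m0 mj]; have mk := leq_ltn_trans mj j1.
  have [r [rN' [/(sum_iterP m0 mk rN') -> /congB_mod]]] := H m (Q8N mk) m0 mk.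
  by rewrite E.
exists (\sum_(q <- Q) (y q * pinv q) %% m); split; first exact: rN.
split; first by apply/sum_iterP => //; exact: rN.
by apply/congBP; rewrite ?E ?rN ?Sq_ltN.
Qed.
End Reconstruct.

Let X : int := (\det (\matrix_(i < k, j < k) (a i j)%:Z))%R.

Lemma det_red (q : nat) :
  (\det (\matrix_(i < k, j < k) (a i j)%:R) = X%:~R :> 'F_q)%R.
Proof.
rewrite /X -(det_map_mx intr); congr (\det _)%R.
by apply/matrixP => i j; rewrite !mxE.
Qed.

Lemma det_modBP v : v < N -> det_modB N k s A p v <->
  v = (\det (\matrix_(i < k, j < k) (a i j)%:R) : 'F_p)%R.
Proof.
move=> vN.
have k8 : 4 * size Q < 4 * k ^ 8 + 1 by rewrite addn1 ltnS leq_pmul2l // Q_size.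
have natF (q : nat) (x : 'F_q) : ((x : nat)%:R = x)%R by exact: natr_Zp.
have [X1 X2] : (4 * `|1 : int| < (\prod_(q <- Q) q)%:Z)%R /\
    (4 * `|X| < (\prod_(q <- Q) q)%:Z)%R.
  have pos : 0 < k ^ k * p ^ k by rewrite muln_gt0 !expn_gt0 k0 p0.
  have : (`|X| <= (k ^ k * p ^ k)%:Z)%R.
    apply: det_int_bound => i j; rewrite mxE; have := a_lt i j; lia.
  by move: Q_large; lia.
have wE : {in Q, forall q, ((weight q)%:R = ((coprod Q q)%:R)^-1 :> 'F_q)%R}.
  by move=> q qQ; apply: natF.
have Y1 : {in Q, forall q, (((weight q * coprod Q q)%:R : 'F_q) = 1%:~R)%R}.
  by move=> q qQ; rewrite natrM wE // mulVf // coprod_neq0.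
have Y2 : {in Q, forall q, (((digit q * coprod Q q)%:R : 'F_q) = X%:~R)%R}.
  move=> q qQ; have q_pr := allP crt_primes_prime q qQ.
  rewrite natrM /digit Fp_nat_mod // natrM wE // natF.
  by rewrite -mulrA mulVf ?coprod_neq0 // mulr1 det_red.
have [r1 [E1 R1]] := crt_rank crt_primes_uniq crt_primes_prime X1 k8 Y1.
have [r2 [E2 R2]] := crt_rank crt_primes_uniq crt_primes_prime X2 k8 Y2.
have M1 := crt_mod crt_primes_uniq p_pr p_notin_crt_primes pinvM E1.
have M2 := crt_mod crt_primes_uniq p_pr p_notin_crt_primes pinvM E2.
have wlt : {in Q, forall q, weight q < q} by move=> q; exact: weight_lt.
have dlt : {in Q, forall q, digit q < q} by move=> q; exact: digit_lt.
have wP : forall q z, q \in Q -> z < N -> crt_weight N k s p q z <-> z = weight q.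
  by move=> q z qQ zN; exact: (weightP qQ zN).
have dP : forall q z, q \in Q -> z < N -> crt_digit N k s A p q z <-> z = digit q.
  by move=> q z qQ zN; exact: (digitP qQ zN).
set s1 := \sum_(q <- Q) weight q * pinv q in M1.
set s2 := \sum_(q <- Q) digit q * pinv q in M2.
set P := (\prod_(q <- Q) q) in M1 M2 E1 E2.
have {}M1 : (P%:R * (s1%:R - r1%:R) = 1 :> 'F_p)%R by rewrite M1.
(* Multiplication by P, which is invertible because P (s1 - r1) = 1, turns the congruence into w =
   X. *)
have key (w : nat) : (w * s1 + r2 = s2 + w * r1 %[mod p]) <-> (w%:R = X%:~R :> 'F_p)%R.
  split=> [/(eq_modFp _ _ p_pr)|e]; [|apply/(eq_modFp _ _ p_pr)]; rewrite !natrD !natrM.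
    move=> e; rewrite -M2.
    transitivity (w%:R * (P%:R * (s1%:R - r1%:R)) : 'F_p)%R; first by rewrite M1 mulr1.
    have -> : (s2%:R = w%:R * s1%:R + r2%:R - w%:R * r1%:R :> 'F_p)%R.
      by rewrite e addrK.
    by ring.
  rewrite e; apply/eqP; rewrite -subr_eq0.
  have PP : (P%:R != 0 :> 'F_p)%R.
    apply/eqP => P0; move: M1; rewrite P0 mul0r => /eqP.
    by rewrite eq_sym oner_eq0.
  rewrite -(mulrI_eq0 _ (mulfI PP)); apply/eqP.
  transitivity (X%:~R * (P%:R * (s1%:R - r1%:R)) - P%:R * (s2%:R - r2%:R) : 'F_p)%R.
    by ring.
  by rewrite M1 M2 mulr1 subrr.
have W1 := rankBP wlt wP; have W2 := rankBP dlt dP.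
have S1 := sumBP wlt wP; have S2 := sumBP dlt dP.
rewrite det_red; split.
  case=> vp [t1 [_ [t2 [_ [u1 [u1N [u2 [u2N]]]]]]]].
  case=> /W1/R1 -> [/W2/R2 ->] [/(S1 _ u1N) -> [/(S2 _ u2N) ->]] /congB_mod/key.
  by move/(congr1 val) => /=; rewrite val_Fp_nat // modn_small.
move=> ev; have vp : v < p by rewrite ev; exact: Fp_lt.
have K0 : 0 < 4 * k ^ 8 + 1 by rewrite addn1.
have [/(round_le K0)/leq_trans/(_ (Rq_le wlt)) r1le _] := (R1 r1).2 erefl.
have [/(round_le K0)/leq_trans/(_ (Rq_le dlt)) r2le _] := (R2 r2).2 erefl.
have s1N : s1 < N := Sq_ltN wlt; have s2N : s2 < N := Sq_ltN dlt.
split=> //; exists r1; split; first exact: leq_ltn_trans r1le TltN.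
exists r2; split; first exact: leq_ltn_trans r2le TltN.
exists s1; split=> //; exists s2; split=> //.
split; first by apply/W1/R1.
split; first by apply/W2/R2.
split; first by apply/S1.
split; first by apply/S2.
have B1 : s1 <= k ^ 16 * p := Sq_lt wlt.
have B2 : s2 <= k ^ 16 * p := Sq_lt dlt.
(* Both sides of the congruence have to lie below N: v s1 and s2 are at most k^16 p^2, while r2 and
   v r1 are at most k^18 p. The hypothesis p^2 k^20 <= N covers the sum. *)
have big : k ^ 16 * p * p + k ^ 18 * p < N.
  apply: leq_trans pN; rewrite (_ : 20 = 16 + (2 + 2)) // (_ : 18 = 16 + 2) // !expnD.
  have : 0 < k ^ 16 * p by rewrite muln_gt0 expn_gt0 k0.
  have z2 : 8 < k ^ 2 by rewrite (@leq_exp2r 3 k 2).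
  have : p + k ^ 2 < p * (k ^ 2 * k ^ 2).
    have p1 := prime_gt1 p_pr; move: (k ^ 2) z2 => z z8.
    apply: (@leq_ltn_trans (p * z)); last by rewrite ltn_pmul2l // ltn_Pmull //; lia.
    by clear -p1 z8; nia.
  move: (k ^ 16) (k ^ 2) => u z lt u0.
  have -> : u * p * p + u * z * p = u * p * (p + z) by lia.
  have -> : p * p * (u * (z * z)) = u * p * (p * (z * z)) by lia.
  by rewrite ltn_pmul2l.
have pp := prime_gt1 p_pr.
apply/congBP => //; last by apply/key; rewrite ev natF -det_red.
- apply: leq_ltn_trans big; apply: leq_add; last exact: leq_trans r2le (leq_pmulr _ p0).
  by rewrite mulnC leq_mul // ltnW.
- apply: leq_ltn_trans big; apply: leq_add.
    exact: leq_trans B2 (leq_pmulr _ p0).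
  by rewrite mulnC leq_mul // ltnW.
Qed.
End DetModP.

(** * Existence of the moduli and choice of the constants *)

Lemma count_primes_gt n m :
  nprimes m - n.+1 <= size [seq q <- iota 0 m | prime q && (n < q)].
Proof.
rewrite leq_subLR -[X in X + _](size_iota 0) -size_cat; apply: uniq_leq_size.
  by rewrite filter_uniq ?iota_uniq.
move=> q; rewrite mem_cat !mem_filter !mem_iota !add0n !leq0n ltnS /= => /andP[-> ->].
by rewrite andbT; case: leqP.
Qed.

(** Chinese remaindering gives s the residues 0, ..., k modulo k + 1 primes between k^18 and k^38.
    The least prime that leaves residue i may differ from the one chosen for i, but it is no
    larger. *)
Lemma exists_slots N k : k ^ (38 * k.+1) <= N -> 1 < k ->
  k.+1 <= nprimes (k ^ 38) - (k ^ 18).+1 -> exists2 s, s < N & slotsB N k s.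
Proof.
move=> roomN k2 many.
have k38 : k ^ 38 <= N by apply: expn38_room.
pose r := [seq q <- iota 0 (k ^ 38) | prime q && (k ^ 18 < q)].
have rs : k < size r by apply: leq_trans many _; apply: count_primes_gt.
have Ur : uniq r by rewrite /r filter_uniq ?iota_uniq.
have rP (i : 'I_k.+1) : [/\ prime (nth 0 r i), k ^ 18 < nth 0 r i & nth 0 r i < k ^ 38].
  have : nth 0 r i \in r by rewrite mem_nth // (leq_trans (ltn_ord i)).
  by rewrite {2}/r mem_filter mem_iota add0n => /andP[/andP[-> ->] /andP[_ ->]].
have [|||s slt sE] := @crt_seq _ (enum 'I_k.+1) (fun i => nth 0 r i) (fun i => i).
- exact: enum_uniq.
- by move=> i _; have [] := rP i.
- move=> i j _ _ /eqP; rewrite nth_uniq //; first by move=> /eqP/val_inj.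
    by rewrite (leq_trans (ltn_ord i)).
  by rewrite (leq_trans (ltn_ord j)).
have sN : s < N.
  apply: leq_trans slt _; apply: leq_trans roomN; rewrite expnM.
  apply: (@leq_trans (\prod_(i <- enum 'I_k.+1) k ^ 38)).
    by apply: leq_prod => i _; have [_ _ /ltnW] := rP i.
  by rewrite big_const_seq count_predT iter_muln_1 size_enum_ord.
exists s => // i _ ik.
pose good q := [&& k ^ 18 < q, prime q & s %% q == i].
pose o : 'I_k.+1 := inord i; have io : i = o :> nat by rewrite inordK.
have [h1 h2 h3] := rP o.
have lt : o < nth 0 r o.
  apply: leq_ltn_trans h2; rewrite -io; apply: leq_trans ik _.
  by rewrite -{1}(expn1 k) leq_exp2l.
have go : good (nth 0 r o).
  by rewrite /good h1 h2 /= sE ?mem_enum // modn_small // io.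
have [q /and3P[q1 q2 /eqP q3] qmin] := ex_minnP (ex_intro good _ go).
have qlt : q < k ^ 38 by apply: leq_ltn_trans h3; apply: qmin.
have qN : q < N := leq_trans qlt k38.
exists q; split=> //; split=> //; split=> //; split; first by apply/primeBP.
split; first by apply/remBP; rewrite ?prime_gt0.
move=> x xN [xq [x1 /(primeBP xN) x2]] /(remBP _ _ sN)[_ x3].
have := qmin x; rewrite /good x1 x2 -x3 eqxx leqNgt xq /=.
by move/(_ isT).
Qed.

(** The exponent 2 d + 100 makes room for k^(38 (k + 1)) <= (k^k)^76 <= n^76 and for p^2 k^20 <=
    n^(2 d + 20). *)
Lemma det_defBP d : exists K0, forall n k p A (a : nat -> nat -> nat),
  K0 <= k -> k ^ k <= n -> n < 2 ^ (16 * k.+1 ^ 2) -> prime p -> p < n ^ d ->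
  (forall i j z, A i j z <-> [/\ i < k, j < k & z = a i j]) ->
  (forall i j, a i j < p) -> forall v, v < n ^ (2 * d + 100) ->
  det_defB (n ^ (2 * d + 100)) A p v <->
  v = (\det (\matrix_(i < k, j < k) (a i j)%:R) : 'F_p)%R.
Proof.
have [x0 Hx0] := nprimes_sqr_ge.
pose D := 2 * d + 100.
(* [x0] serves the prime counts. The term 128 D serves N <= 2^(64 k^2 D), where 2 * 64 k^2 D < k^8
   is needed, and the comparison of 4 k^k p^k with the product of the primes. *)
exists (x0 + 128 * D + 4) => n k p A a kK kn nk p_pr pd HA a_lt v.
rewrite -/D; set N := n ^ D => vN.
have k3 : 2 < k by lia.
have k2 : 1 < k by lia.
have kxk b : 0 < b -> x0 <= k ^ b.
  move=> b0; apply: (@leq_trans (k ^ 1)); first by rewrite expn1; lia.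
  by rewrite leq_exp2l.
have np b : 0 < b -> k ^ b <= nprimes (k ^ (b * 2)).
  by move=> b0; rewrite expnM; apply: Hx0; apply: kxk.
have n1 : 1 < n.
  apply: leq_trans kn; apply: (@leq_trans (k ^ 1)); first by rewrite expn1.
  by rewrite leq_exp2l // ltnW.
have kn1 : k <= n.
  by apply: leq_trans kn; rewrite -{1}(expn1 k) leq_exp2l // ltnW.
have roomN : k ^ (38 * k.+1) <= N.
  apply: (@leq_trans ((k ^ k) ^ 76)).
    by rewrite -expnM leq_exp2l //; lia.
  apply: (@leq_trans (n ^ 76)); first by rewrite leq_exp2r.
  by rewrite leq_exp2l // /D; lia.
have pN : p * p * k ^ 20 <= N.
  apply: (@leq_trans (n ^ d * n ^ d * n ^ 20)).
    by rewrite !leq_mul // ?(ltnW pd) // leq_exp2r.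
  by rewrite -!expnD leq_exp2l // /D; lia.
have sq : k.+1 ^ 2 <= 4 * k ^ 2 by rewrite -(@expnMn 2 k 2) leq_exp2r //; lia.
have n2 : n <= 2 ^ (64 * k ^ 2).
  by apply: leq_trans (ltnW nk) _; rewrite leq_exp2l //; lia.
have N_lt : exists2 j, j.*2 < k ^ 8 & N <= 2 ^ j.
  exists (64 * k ^ 2 * D).
    rewrite (_ : 8 = 1 + (2 + 5)) // !expnD expn1.
    have : 0 < k ^ 5 by rewrite expn_gt0 ltnW.
    have : 0 < k ^ 2 by rewrite expn_gt0 ltnW.
    have : 128 * D < k by lia.
    move: (k ^ 2) (k ^ 5) => u w dk u0 w0.
    have h1 : 128 * D * u < k * u by rewrite ltn_pmul2r.
    have h2 : k * u <= k * (u * w) by rewrite leq_pmul2l ?leq_pmulr // ltnW.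
    by rewrite -mul2n; clear -h1 h2; lia.
  by rewrite expnM leq_exp2r // /D addnC.
(* At least k^4 - 1 primes other than p lie below k^8, each at least 2, whereas 4 k^k p^k <= 2^(2 +
   k^2 + 64 d k^3). *)
have Q_large : 4 * (k ^ k * p ^ k) <
    \prod_(q <- [seq q <- iota 0 (k ^ 8) | prime q && (q != p)]) q.
  apply: (@leq_trans (2 ^ (k ^ 4 - 1))); last first.
    apply: (@leq_trans (\prod_(q <- [seq q <- iota 0 (k ^ 8) | prime q && (q != p)]) 2)).
      rewrite big_const_seq count_predT iter_muln_1 leq_exp2l // leq_subLR.
      apply: leq_trans (np 4 isT) _; rewrite /nprimes -[4 * 2]/8.
      rewrite -[X in X + _]/(size [:: p]) -size_cat; apply: uniq_leq_size.
        by rewrite filter_uniq ?iota_uniq.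
      move=> q; rewrite mem_cat !mem_filter inE => /andP[-> ->].
      by rewrite andbT; case: eqP.
    rewrite big_seq [X in _ <= X]big_seq; apply: leq_prod => q.
    by rewrite mem_filter => /andP[/andP[/prime_gt1]].
  have e1 : k ^ k <= 2 ^ (k * k).
    by rewrite expnM leq_exp2r ?(ltnW k2) //; apply/ltnW/ltn_expl.
  have e2 : p ^ k <= 2 ^ (64 * k ^ 2 * d * k).
    rewrite expnM leq_exp2r ?(ltnW k2) //; apply: leq_trans (ltnW pd) _.
    by rewrite expnM; case: (d) => // d'; rewrite leq_exp2r.
  apply: (@leq_ltn_trans (2 ^ (2 + (k * k + 64 * k ^ 2 * d * k)))).
    by rewrite !expnD leq_mul // leq_mul.
  rewrite ltn_exp2l // (_ : 4 = 1 + (1 + 2)) // !expnD expn1.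
  have -> : k ^ 2 = k * k by rewrite mulnn.
  have : 128 * d + 100 < k by rewrite /D in kK; lia.
  have : 0 < k * k by lia.
  move: (k * k) => u.
  move: k3; clear => k3 u0 dk.
  have h1 : (128 * d + 100) * (k * u) <= k * (k * u) by rewrite leq_mul2r (ltnW dk) orbT.
  have h2 : 3 * u <= k * u by rewrite leq_mul2r k3 orbT.
  have e : 64 * u * d * k = 64 * (d * (k * u)) by lia.
  move: h1 h2; rewrite e; move: (k * u) => y; rewrite mulnDl -mulnA.
  move: (d * y) (k * y) => w z; move: u0; clear; lia.
have [|s sN Hs] := @exists_slots N k roomN k2.
  have := np 19 isT; rewrite -[19 * 2]/38; move: (nprimes _) => y.
  rewrite (_ : 19 = 1 + 18) // expnD expn1.
  have : k <= k ^ 18 by rewrite -{1}(expn1 k) leq_exp2l.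
  move: (k ^ 18) => u; move: kK; clear; nia.
have aN i j : a i j < N.
  apply: ltn_trans (a_lt i j) _; apply: leq_trans pN.
  rewrite -mulnA; apply: leq_trans (_ : p.+1 <= p * p) _.
    by have := prime_gt1 p_pr; nia.
  by rewrite leq_mul2l leq_pmulr ?orbT // expn_gt0 ltnW.
have kN := k_room k2 roomN.
have sz : sizeB N A k.
  split=> [i _ ik|[z [_ /HA[]]]]; last by rewrite ltnn.
  by exists (a i 0); split=> //; apply/HA; split=> //; apply: ltnW.
have szE k' : k' < N -> sizeB N A k' -> k' = k.
  move=> kN' [h1 h2]; apply/eqP; rewrite eqn_leq; apply/andP; split.
    rewrite leqNgt; apply/negP => lt.
    by have [z [_ /HA[]]] := h1 k kN lt; rewrite ltnn.
  rewrite leqNgt; apply/negP => lt; apply: h2; exists (a k' 0); split=> //.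
  by apply/HA; split=> //; apply: ltnW.
split=> [[k' [kN' [s' [sN' [/szE -> // [Hs' /det_modBP h]]]]]]|ev].
  by apply: h.
exists k; split=> //; exists s; split=> //; do 2!split=> //.
apply/(det_modBP HA p_pr a_lt k3 sN Hs roomN pN N_lt Q_large) => //.
Qed.

(** * The bounds on log n / log log n *)

Section LogBounds.
Local Open Scope ring_scope.
Variable R : realType.
Implicit Type n : nat.
Let ln2_gt0 : 0 < ln 2 :> R. Proof. by rewrite ln_gt0 // ltr1n. Qed.

Lemma ln_natX (a b : nat) : (0 < a)%N -> ln ((a ^ b)%N%:R : R) = b%:R * ln a%:R.
Proof. by move=> a0; rewrite natrX lnXn ?ltr0n // mulr_natl. Qed.

Lemma ler_ln_nat (a b : nat) : (0 < a)%N -> (0 < b)%N ->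
  (ln (a%:R : R) <= ln b%:R) = (a <= b)%N.
Proof. by move=> a0 b0; rewrite ler_ln ?posrE ?ltr0n // ler_nat. Qed.

Lemma ltr_ln_nat (a b : nat) : (0 < a)%N -> (0 < b)%N ->
  (ln (a%:R : R) < ln b%:R) = (a < b)%N.
Proof. by move=> a0 b0; rewrite ltr_ln ?posrE ?ltr0n // ltr_nat. Qed.

Let y n : R := log2 n%:R.
Let ell n : R := log2 (y n).

Lemma y_ln n : y n * ln 2 = ln n%:R.
Proof. by rewrite /y /log2 divfK // gt_eqF. Qed.

(** The case n = 3 determines this bound and the next: 2^3 <= 3^2 gives log 3 >= 3/2, and 2 <=
    (3/2)^2 gives log log 3 >= 1/2. *)
Lemma y_gt n : (2 < n)%N -> 3 / 2 <= y n.
Proof.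
move=> n2; rewrite -(ler_pM2r ln2_gt0) y_ln.
have : ln (8%:R : R) <= ln (n ^ 2)%N%:R.
  by rewrite ler_ln_nat ?expn_gt0 ?(ltn_trans _ n2) // (@leq_trans (3 ^ 2)) // leq_exp2r.
rewrite -[8%N]/(2 ^ 3)%N !ln_natX ?(ltn_trans _ n2) //; lra.
Qed.

Lemma ell_gt n : (2 < n)%N -> 1 / 2 <= ell n.
Proof.
move=> n2; rewrite -(ler_pM2r ln2_gt0) /ell /log2 divfK ?gt_eqF //.
have y0 := y_gt n2.
have h : ln (3 / 2 : R) <= ln (y n) by rewrite ler_ln ?posrE //; lra.
have : ln (2 : R) <= ln ((3 / 2) ^+ 2).
  by rewrite ler_ln ?posrE //; lra.
have h0 : 0 < 3 / 2 :> R by lra.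
rewrite (lnXn 2 h0).
by rewrite -[ln _ *+ 2]mulr_natl; lra.
Qed.

Lemma k_itv n : (2 < n)%N ->
  (log_div_loglog R n)%:R * ell n <= y n /\ y n < (log_div_loglog R n).+1%:R * ell n.
Proof.
move=> n2; have y0 := y_gt n2; have l0 := ell_gt n2.
have lp : 0 < ell n by lra.
have q0 : 0 <= y n / ell n by rewrite divr_ge0 //; lra.
have /andP[h1 h2] := truncn_itv q0.
by rewrite -ler_pdivlMr // -ltr_pdivrMr.
Qed.

(** For n >= 4 the denominator is at least 1, so the quotient is at most log n <= n. For n = 3 the
    denominator is at least 1/2 and log 3 < 2, so the quotient is below 4. *)
Lemma log_div_loglog_le n : (2 < n)%N -> (log_div_loglog R n <= n)%N.
Proof.
move=> n2; have [h _] := k_itv n2; have y0 := y_gt n2; have l0 := ell_gt n2.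
set k := log_div_loglog R n in h *.
have yn : y n <= n%:R.
  rewrite -(ler_pM2r ln2_gt0) y_ln -ln_natX // ler_ln_nat ?expn_gt0 ?(ltn_trans _ n2) //.
  exact/ltnW/ltn_expl.
have [n4|n3] := leqP 4 n.
  have y2 : 2 <= y n.
    rewrite -(ler_pM2r ln2_gt0) y_ln -ln_natX // ler_ln_nat // (ltn_trans _ n2) //.
  have l1 : 1 <= ell n.
    rewrite -(ler_pM2r ln2_gt0) mul1r /ell /log2 divfK ?gt_eqF // ler_ln ?posrE //; lra.
  rewrite -(ler_nat R); apply: le_trans yn; apply: le_trans h.
  by rewrite ler_peMr // ler0n.
have en : n = 3 by apply/eqP; rewrite eqn_leq n2 -ltnS n3.
have y2 : y n < 2.
  by rewrite -(ltr_pM2r ln2_gt0) y_ln -ln_natX // ltr_ln_nat // en.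
rewrite en -ltnS -(ltr_nat R).
have : k%:R * (1 / 2) <= (k%:R * ell n : R) by rewrite ler_wpM2l.
by lra.
Qed.

(** For n >= 4 the denominator is at least 1, so k <= log n. Hence log k <= log log n for k > 0, and
    k log k <= k log log n <= log n. *)
Lemma log_div_loglog_expn n : (3 < n)%N ->
  (log_div_loglog R n ^ log_div_loglog R n <= n)%N.
Proof.
move=> n3; have n2 := ltnW n3; have [h _] := k_itv n2.
set k := log_div_loglog R n in h *.
have y2 : 2 <= y n.
  by rewrite -(ler_pM2r ln2_gt0) y_ln -ln_natX // ler_ln_nat // (ltn_trans _ n2).
have l1 : 1 <= ell n.
  rewrite -(ler_pM2r ln2_gt0) mul1r /ell /log2 divfK ?gt_eqF // ler_ln ?posrE //; lra.
have ky : k%:R <= y n.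
  by apply: le_trans h; rewrite ler_peMr // ler0n.
have [->|k0] := posnP k; first by apply: leq_trans n2.
rewrite -ler_ln_nat ?expn_gt0 ?k0 ?(ltn_trans _ n2) // ln_natX // -(y_ln n).
apply: (@le_trans _ _ (k%:R * ell n * ln 2)); last by rewrite ler_pM2r.
rewrite -mulrA ler_wpM2l ?ler0n // /ell /log2 divfK ?gt_eqF //.
by rewrite ler_ln ?posrE ?ltr0n //; lra.
Qed.

(** With r the square root of log n, log log n = 2 log r <= 4 r, because ln r <= r and ln 2 >= 1/2.
    So r^2 < 4 (k + 1) r, and log n = r^2 < 16 (k + 1)^2. *)
Lemma log_div_loglog_large n : (2 < n)%N ->
  (n < 2 ^ (16 * (log_div_loglog R n).+1 ^ 2))%N.
Proof.
move=> n2; have [_ h] := k_itv n2; have y0 := y_gt n2.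
set k := log_div_loglog R n in h *.
have n0 : (0 < n)%N by apply: ltn_trans n2.
rewrite -ltr_ln_nat ?expn_gt0 // ln_natX // -(y_ln n) ltr_pM2r //.
pose r := Num.sqrt (y n).
have r0 : 0 < r by rewrite sqrtr_gt0; lra.
have ry : r ^+ 2 = y n by rewrite sqr_sqrtr //; lra.
have ln2_ge : 1 / 2 <= ln 2 :> R.
  have : ln (1 + (- (1 / 2)) : R) <= - (1 / 2) by apply: le_ln1Dx; lra.
  have -> : 1 + - (1 / 2) = 2^-1 :> R by lra.
  by rewrite lnV ?posrE //; lra.
have lr : ln r <= r.
  have : ln (1 + (r - 1)) <= r - 1 by apply: le_ln1Dx; lra.
  by rewrite addrC subrK; lra.
have l4 : ell n <= 4 * r.
  rewrite -(ler_pM2r ln2_gt0) /ell /log2 divfK ?gt_eqF // -ry lnXn // -[ln _ *+ 2]mulr_natl.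
  have : 4 * r * (1 / 2) <= 4 * r * ln 2 by rewrite ler_wpM2l //; lra.
  by lra.
have K0 : 0 < k.+1%:R :> R by rewrite ltr0n.
have h2 : r * r < k.+1%:R * (4 * r).
  by rewrite -expr2 ry; apply: lt_le_trans h _; rewrite ler_pM2l.
have r4 : r < 4 * k.+1%:R by rewrite -(ltr_pM2r r0); lra.
rewrite -ry natrM natrX.
have : r * r < 4 * k.+1%:R * (4 * k.+1%:R).
  by apply: ltr_pM => //; apply: ltW.
by rewrite !expr2; lra.
Qed.
End LogBounds.

(** * Domains of bounded size, and the theorem *)

Section Small.
Variable d : nat.

(** The syntax has no constant for truth and V may be empty, hence a quantified equation. *)
Definition ftrue V : formula d V := fAll (fEq d None None).
Definition fall V (s : seq (formula d V)) : formula d V := foldr (@fAnd d V) (ftrue V) s.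
Definition fany V (s : seq (formula d V)) : formula d V :=
  foldr (@fOr d V) (fNot (ftrue V)) s.

Section Sat.
Variables (n : nat) (M : d.-tuple 'I_n -> d.-tuple 'I_n -> d.-tuple 'I_n -> bool).

Lemma sat_ftrue V (e : V -> 'I_n) : sat M e (ftrue V).
Proof. by apply/forallP => a /=. Qed.

Lemma sat_fall T V (e : V -> 'I_n) (F : T -> formula d V) s :
  sat M e (fall (map F s)) = all (fun x => sat M e (F x)) s.
Proof. by elim: s => [|x s /= ->] //; exact: sat_ftrue. Qed.

Lemma sat_fany T V (e : V -> 'I_n) (F : T -> formula d V) s :
  sat M e (fany (map F s)) = has (fun x => sat M e (F x)) s.
Proof. by elim: s => [|x s /= ->] //; apply/negbF; exact: sat_ftrue. Qed.
End Sat.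

(* x has the value i. *)
Fixpoint fval V (i : nat) (x : V) : formula d V :=
  if i is j.+1 then
    fEx (fAnd (fAnd (fval j None) (fNot (fLe d (Some x) None)))
      (fAll (fOr (fLe d None (Some None)) (fLe d (Some (Some x)) None))))
  else fAdd d x x x.

Lemma sat_fval n (M : d.-tuple 'I_n -> d.-tuple 'I_n -> d.-tuple 'I_n -> bool)
    V i (x : V) (e : V -> 'I_n) :
  sat M e (fval i x) = (e x == i :> nat).
Proof.
elim: i V x e => [|i IH] V x e /=; first by apply/eqP/eqP; lia.
apply/existsP/eqP => [[a]|ex].
  rewrite IH /= -ltnNge => /andP[/andP[/eqP ai lt] /forallP H].
  apply/eqP; rewrite eqn_leq -ai lt andbT leqNgt; apply/negP => lt2.
  have bn : a.+1 < n by apply: leq_ltn_trans (ltn_ord (e x)); apply: ltnW.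
  have := H (Ordinal bn); rewrite /= ltnn /=; lia.
have bn : i < n by apply: leq_ltn_trans (ltn_ord (e x)); rewrite ex.
exists (Ordinal bn); rewrite IH /= eqxx -ltnNge ex leqnn /=.
by apply/forallP => b; case: leqP.
Qed.

Definition fsize_ge V m : formula d V :=
  if m is m'.+1 then fEx (fval m' None) else ftrue V.

Lemma sat_fsize_ge n (M : d.-tuple 'I_n -> d.-tuple 'I_n -> d.-tuple 'I_n -> bool)
    V m (e : V -> 'I_n) : sat M e (fsize_ge V m) = (m <= n).
Proof.
case: m => [|m]; first exact: sat_ftrue.
rewrite /fsize_ge /=; apply/existsP/idP => [[a]|mn]; first by rewrite sat_fval /= => /eqP <-.
by exists (Ordinal mn); rewrite sat_fval /=.
Qed.

(** Over a domain of fixed size every property is a finite table. The m elements are named by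
    existential variables, and the formula is the disjunction, over all pairs of a relation and an
    assignment with property G, of their complete descriptions. *)
Lemma fixed_size_definable (V : finType) m
    (G : (d.-tuple 'I_m -> d.-tuple 'I_m -> d.-tuple 'I_m -> bool) ->
         (V -> 'I_m) -> Prop) :
  exists phi : formula d V,
  (forall M e, sat M e phi <-> G M e) /\
  (forall n (M : d.-tuple 'I_n -> d.-tuple 'I_n -> d.-tuple 'I_n -> bool) e,
     sat M e phi -> n = m).
Proof.
pose TT := (d.-tuple 'I_m * d.-tuple 'I_m * d.-tuple 'I_m)%type.
pose tab := ({ffun TT -> bool} * {ffun V -> 'I_m})%type.
pose W := (V + 'I_m)%type.
pose inr' (t : d.-tuple 'I_m) : d.-tuple W := map_tuple inr t.
pose lit (T : tab) (t : TT) : formula d W :=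
  let a := fMat (inr' t.1.1) (inr' t.1.2) (inr' t.2) in
  if T.1 t then a else fNot a.
pose chk (T : tab) : formula d W := fAnd
  (fall (map (lit T) (enum {: TT})))
  (fall (map (fun v => fEq d (inl v) (inr (T.2 v))) (enum V))).
pose ok (T : tab) : bool := `[< G (fun r c v => T.1 (r, c, v)) T.2 >].
pose body : formula d W := fAnd
  (fall (map (fun i : 'I_m => fval i (inr i)) (enum 'I_m)))
  (fany (map chk [seq T <- enum {: tab} | ok T])).
have [phi Hphi] := exists_block body.
exists (fAnd (fAnd (fsize_ge V m) (fNot (fsize_ge V m.+1))) phi).
have S n M (e : V -> 'I_n) :
    sat M e (fAnd (fAnd (fsize_ge V m) (fNot (fsize_ge V m.+1))) phi) =
    [&& m <= n, ~~ (m < n) & sat M e phi].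
  rewrite -[LHS]/((sat M e (fsize_ge V m) && ~~ sat M e (fsize_ge V m.+1)) && _).
  by rewrite !sat_fsize_ge andbA.
split=> [M e|n M e]; rewrite S; last first.
  by case/and3P=> h1 h2 _; apply/eqP; rewrite eqn_leq h1 leqNgt h2.
rewrite leqnn ltnn /= Hphi.
have litE (f : 'I_m -> 'I_m) : (forall i, f i = i) -> forall t : TT,
    sat M (env_sum e f) (fMat (inr' t.1.1) (inr' t.1.2) (inr' t.2)) = M t.1.1 t.1.2 t.2.
  move=> fi t /=; have E (u : d.-tuple 'I_m) : map_tuple (env_sum e f) (inr' u) = u.
    by apply: eq_from_tnth => j; rewrite !tnth_map /= fi.
  by rewrite !E.
split.
  case=> f /=; rewrite sat_fall sat_fany => /andP[/allP Hf].
  have fi i : f i = i.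
    have := Hf i; rewrite mem_enum => /(_ isT); rewrite sat_fval /= => /eqP.
    exact: val_inj.
  case/hasP=> T; rewrite mem_filter => /andP[/asboolP GT _] /=.
  rewrite !sat_fall => /andP[/allP HM /allP He].
  have -> : M = (fun r c v => T.1 (r, c, v)).
    apply: funext => r; apply: funext => c; apply: funext => v.
    have := HM (r, c, v); rewrite mem_enum => /(_ isT); rewrite /lit.
    have := litE f fi (r, c, v); rewrite /= => E.
    by case: ifP => _ /=; rewrite E => // /negbTE.
  have -> // : e = T.2.
  apply: funext => v; have := He v; rewrite mem_enum => /(_ isT) /=.
  by rewrite fi => /eqP.
move=> GM; exists id; rewrite /= sat_fall sat_fany; apply/andP; split.
  by apply/allP => i _; rewrite sat_fval.
pose T : tab := ([ffun t : TT => M t.1.1 t.1.2 t.2], [ffun v => e v]).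
apply/hasP; exists T.
  rewrite mem_filter mem_enum andbT; apply/asboolP; move: GM; congr (G _ _).
    apply: funext => r; apply: funext => c; apply: funext => v.
    by rewrite ffunE.
  by apply: funext => v; rewrite ffunE.
rewrite /= !sat_fall; apply/andP; split; apply/allP => t _.
  rewrite /lit ffunE; case E: (M _ _ _) => /=; have := litE id (fun=> erefl) t;
    by rewrite /= E => ->.
by rewrite /= ffunE.
Qed.
End Small.

(** * Large domains, small domains and the theorem *)

Section Main.
Variables (R : realType) (d : nat).
Notation k n := (log_div_loglog R n).
Definition inst := {n : nat & {p : nat & 'M['F_p]_(k n)}}.
Definition inst_size (i : inst) : nat := projT1 i.
Definition inst_mx (i : inst) := projT2 (projT2 i).
Definition inst_rel (i : inst) := @mx_rel (inst_size i) d _ _ (inst_mx i).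

Definition entry_nat p m (A : 'M['F_p]_m) (i j : nat) : nat :=
  if insub i is Some i' then if insub j is Some j' then A i' j' else 0 else 0.

Lemma entry_natE p m (A : 'M['F_p]_m) (i j : 'I_m) : entry_nat A i j = A i j.
Proof. by rewrite /entry_nat !valK. Qed.

Lemma tuple_num_surj n x : x < n ^ d -> exists t : d.-tuple 'I_n, tuple_num t = x.
Proof.
case/num_surj=> f <-; exists [tuple f j | j < d].
by apply: eq_bigr => j _; rewrite tnth_mktuple.
Qed.

Lemma tuple_num_lt n (t : d.-tuple 'I_n) : tuple_num t < n ^ d.
Proof. exact: num_lt. Qed.

(** The bounds on p and m provide a d-tuple for every row, column and entry, so the relation carries
    the whole matrix. *)
Lemma mx_relP n p m (A : 'M['F_p]_m) x y z : prime p -> p < n ^ d -> m <= n ^ d ->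
  (exists r c v : d.-tuple 'I_n,
    [/\ tuple_num r = x, tuple_num c = y, tuple_num v = z & mx_rel A r c v]) <->
  [/\ x < m, y < m & z = entry_nat A x y].
Proof.
move=> p_pr pd md; split=> [[r [c [v [<- <- <-]]]]|[xm ym ez]].
  case/existsP=> i /existsP[j /and3P[/eqP-> /eqP-> /eqP->]].
  by rewrite entry_natE !ltn_ord.
have [r er] := tuple_num_surj (leq_trans xm md).
have [c ec] := tuple_num_surj (leq_trans ym md).
have zp : z < p.
  rewrite ez /entry_nat; case: insubP => [i _ _|_]; last exact: prime_gt0.
  case: insubP => [j _ _|_]; last exact: prime_gt0.
  exact: Fp_lt.
have [v ev] := tuple_num_surj (ltn_trans zp pd).
exists r, c, v; split=> //; apply/existsP; exists (Ordinal xm).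
apply/existsP; exists (Ordinal ym); rewrite er ec ev ez !eqxx /=.
by rewrite -[x]/(nat_of_ord (Ordinal xm)) -[y]/(nat_of_ord (Ordinal ym)) entry_natE.
Qed.

Lemma dim_le n p : 2 < n -> prime p -> p < n ^ d -> k n <= n ^ d.
Proof.
move=> n2 p_pr pd; apply: leq_trans (log_div_loglog_le R n2) _.
case: (d) pd => [|d' _]; last by rewrite -{1}(expn1 n) leq_pexp2l // ltnW // ltnW.
by rewrite expn0 ltnS leqn0 => /eqP p0; move: p_pr; rewrite p0.
Qed.

Lemma large_definable : exists (phi : formula d ('I_d + 'I_d)) (n0 : nat),
  forall n p (A : 'M['F_p]_(k n)), n0 <= n -> 2 < n -> prime p -> p < n ^ d ->
  forall x v : d.-tuple 'I_n, tuple_num x = p ->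
  sat (mx_rel A) (env2 x v) phi <-> tuple_num v = (\det A)%R.
Proof.
have [K0 HK] := det_defBP d.
pose D := 2 * d + 100.
have dD : d <= D by rewrite /D; lia.
have H := NumDef_det_defB inst_rel D true false.
(* The arguments arrive as d-tuples while the formula works with D digits; [a] and [b] are the
   D-digit copies of p and of the value, the variables [true] and [false] of [H]. *)
pose P (i : inst) (e : 'I_d + 'I_d -> 'I_(inst_size i)) := exists a b : 'I_D -> 'I_(inst_size i),
  num a = num (fun j => e (inl j)) /\ num b = num (fun j => e (inr j)) /\
  det_defB (inst_size i ^ D) (@matB d inst inst_size inst_rel i) (num a) (num b).
have [phi [n0 Hphi]] : FODef inst_rel P.
  have eqD W (u : 'I_D -> W) (w : 'I_d -> W) :
      FODef inst_rel (fun i e => num (fun j => e (u j)) = num (fun j => e (w j))).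
    apply: (FODef_eqRD (c := D)); try exact: ResDef_num.
      by exists 0 => i e _; exact: num_lt.
    exists 1 => i e s1; apply: leq_trans (num_lt _) _.
    by rewrite leq_pexp2l.
  apply: FODef_exs; apply: FODef_exs.
  apply: FODef_and; first exact: (eqD _ (fun j => inl (inr j)) (fun j => inl (inl (inl j)))).
  apply: FODef_and; first exact: (eqD _ (fun j => inr j) (fun j => inl (inl (inr j)))).
  exact: (FODef_rename (fun w : bool * 'I_D => if w.1 then inl (inr w.2) else inr w.2 :
     'I_d + 'I_d + 'I_D + 'I_D) H).
(* The middle term forces k >= K0 through [log_div_loglog_large]; the last one gives n > 3, as
   [log_div_loglog_expn] requires. *)
exists phi, (n0 + 2 ^ (16 * K0 ^ 2) + 4) => n p A nge n2 p_pr pd x v xp.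
pose i : inst := existT _ n (existT _ p A).
have ni : n0 <= inst_size i by rewrite /inst_size /=; lia.
have n3 : 3 < n by lia.
have Kk : K0 <= k n.
  rewrite leqNgt; apply/negP => lt.
  have := log_div_loglog_large R n2; rewrite ltnNge => /negP; apply.
  apply: (@leq_trans (2 ^ (16 * K0 ^ 2))); last by lia.
  by rewrite leq_exp2l // leq_mul2l leq_exp2r.
have kd : k n <= n ^ d by exact: dim_le n2 p_pr pd.
have nD m : m < n ^ d -> m < n ^ D.
  by move=> h; apply: leq_trans h _; rewrite leq_pexp2l // ltnW // ltnW.
have a_lt i0 j0 : entry_nat A i0 j0 < p.
  rewrite /entry_nat; case: insubP => [i' _ _|_]; last exact: prime_gt0.
  case: insubP => [j' _ _|_]; last exact: prime_gt0.
  exact: Fp_lt.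
have detE : (\det (\matrix_(i0 < k n, j0 < k n) (entry_nat A i0 j0)%:R) = \det A :> 'F_p)%R.
  congr (\det _)%R; apply/matrixP => i0 j0; rewrite mxE entry_natE.
  exact: natr_Zp.
have {HK} spec w : w < n ^ D -> det_defB (n ^ D) (@matB d inst inst_size inst_rel i) p w <->
    w = (\det A)%R.
  move=> wN; rewrite -detE; apply: (HK n (k n)) => //.
  - exact: log_div_loglog_expn.
  - exact: log_div_loglog_large.
  by move=> a b z; exact: mx_relP.
have vnum : num (fun j => env2 x v (inr j)) = tuple_num v by [].
have xnum : num (fun j => env2 x v (inl j)) = p by rewrite -xp.
rewrite (Hphi i ni (env2 x v)) /P vnum xnum; split.
  by case=> a [b [-> [-> /spec]]]; apply; apply: nD; exact: tuple_num_lt.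
move=> ev; have [a ea] := num_surj (nD _ pd).
have [b eb] := num_surj (nD _ (tuple_num_lt v)).
exists a, b; split=> //; split=> //; rewrite ea eb; apply/spec => //.
by apply: nD; exact: tuple_num_lt.
Qed.

(** A table sees the matrix only through its relation; injectivity ensures that the determinant it
    lists is the one of A. *)
Lemma mx_rel_inj n p m (A B : 'M['F_p]_m) : prime p -> p < n ^ d -> m <= n ^ d ->
  @mx_rel n d p m A = mx_rel B -> A = B.
Proof.
move=> p_pr pd md E; apply/matrixP => i j; apply: val_inj => /=.
have /(mx_relP _ _ _ _ p_pr pd md) H :
    [/\ i < m, j < m & entry_nat A i j = entry_nat A i j] by rewrite !ltn_ord.
rewrite E in H; case/(mx_relP _ _ _ _ p_pr pd md): H => _ _.
by rewrite !entry_natE.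
Qed.

Lemma fixed_definable m : 2 < m -> exists phi : formula d ('I_d + 'I_d),
  (forall p (A : 'M['F_p]_(k m)), prime p -> p < m ^ d ->
   forall x v : d.-tuple 'I_m, tuple_num x = p ->
   sat (mx_rel A) (env2 x v) phi <-> tuple_num v = (\det A)%R) /\
  (forall n (M : d.-tuple 'I_n -> d.-tuple 'I_n -> d.-tuple 'I_n -> bool) e,
     sat M e phi -> n = m).
Proof.
move=> m2.
have [phi [H1 H2]] := @fixed_size_definable d ('I_d + 'I_d)%type m
  (fun M e => exists p (A : 'M['F_p]_(k m)), [/\ prime p, p < m ^ d,
     num (fun j => e (inl j)) = p, M = mx_rel A &
     num (fun j => e (inr j)) = (\det A)%R]).
exists phi; split=> // p A p_pr pd x v xp; rewrite H1.
have vnum : num (fun j => env2 x v (inr j)) = tuple_num v by [].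
have xnum : num (fun j => env2 x v (inl j)) = p by rewrite -xp.
split=> [[q [B [q_pr qd]]]|ev]; rewrite vnum xnum; last by exists p, A.
move=> pq; move: B; rewrite -pq => B E ev.
by rewrite (mx_rel_inj p_pr pd (dim_le m2 p_pr pd) E).
Qed.

Lemma small_definable N : exists phi : formula d ('I_d + 'I_d),
  (forall n p (A : 'M['F_p]_(k n)), 2 < n -> n < N -> prime p -> p < n ^ d ->
   forall x v : d.-tuple 'I_n, tuple_num x = p ->
   sat (mx_rel A) (env2 x v) phi <-> tuple_num v = (\det A)%R) /\
  (forall n (M : d.-tuple 'I_n -> d.-tuple 'I_n -> d.-tuple 'I_n -> bool) e,
     sat M e phi -> n < N).
Proof.
elim: N => [|N [phi [H1 H2]]].
  exists (fNot (ftrue d _)); split=> // n M e.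
  by move/negP; case; apply/forallP => a /=.
have [N2|N2] := ltnP 2 N; last first.
  exists phi; split=> [n p A n2|n M e /H2]; last by move/ltnW.
  by rewrite ltnS leqNgt (leq_ltn_trans N2 n2).
have [psi [K1 K2]] := fixed_definable N2.
exists (fOr phi psi); split=> [n p A n2|n M e /=]; last first.
  by case/orP=> [/H2/ltnW|/K2->].
rewrite ltnS leq_eqVlt => /orP[/eqP nN|nN] p_pr pd x v xp.
  subst n; rewrite -(K1 _ A p_pr pd x v xp) /=.
  by split=> [/orP[/H2|//]|->]; rewrite ?ltnn ?orbT.
rewrite -(H1 _ _ A n2 nN p_pr pd x v xp) /=.
by split=> [/orP[//|/K2/eqP]|->//]; rewrite (ltn_eqF nN).
Qed.
End Main.

Theorem theorem8 (R : realType) (c C d : nat) :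
  exists phi : formula d ('I_d + 'I_d),
  forall (n p : nat) (A : 'M['F_p]_(log_div_loglog R n)),
    2 < n -> prime p -> p <= C * n ^ c -> p < n ^ d ->
    forall pbar vbar : d.-tuple 'I_n,
      tuple_num pbar = p ->
      sat (mx_rel A) (env2 pbar vbar) phi = (tuple_num vbar == (\det A)%R).
Proof.
have [phi [N Hphi]] := large_definable R d.
have [psi [H1 H2]] := small_definable R d N.
(* The guard n >= N silences [phi] on small domains, and [psi] can hold only for n < N. *)
exists (fOr psi (fAnd (fsize_ge d _ N) phi)) => n p A n2 p_pr _ pd x v xp.
have -> : sat (mx_rel A) (env2 x v) (fOr psi (fAnd (fsize_ge d _ N) phi)) =
    sat (mx_rel A) (env2 x v) psi || (N <= n) && sat (mx_rel A) (env2 x v) phi.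
  by rewrite -(@sat_fsize_ge d n (@mx_rel n d _ _ A) _ N (env2 x v)).
have [nN|nN] := ltnP n N.
  have S := H1 n p A n2 nN p_pr pd x v xp.
  by rewrite orbF; apply/idP/eqP => /S.
have L := Hphi n p A nN n2 p_pr pd x v xp.
apply/idP/eqP => [/orP[/H2|/L//]|/L h]; first by rewrite ltnNge nN.
by apply/orP; right.
Qed.
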